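(* There is an absolute constant $\alpha>0$ such that the following holds. For every finite point set $X\subseteq\mathbb{R}^d$ and all integers $k\ge 2$, $\ell\ge 1$, the set $C$ of $k$ centers returned by greedy $k$-means++ run on $X$ with parameters $k$ and $\ell$ satisfies \[\mathbb{E}[\phi(X,C)]\le \alpha\,\ell^3\log^3 k\cdot \mathrm{OPT}_k(X),\] i.e. greedy $k$-means++ is an $O(\ell^3\log^3 k)$-approximation algorithm for $k$-means, in expectation.
   Context: For $x\in\mathbb{R}^d$ and a finite set $C\subseteq\mathbb{R}^d$, $\phi(x,C)=\min_{c\in C}\|x-c\|_2^2$, and for $Y\subseteq X$, $\phi(Y,C)=\sum_{x\in Y}\phi(x,C)$. The $k$-means problem asks for $C\subseteq\mathbb{R}^d$ with $|C|=k$ minimizing $\phi(X,C)$; $\mathrm{OPT}_k(X)$ denotes this minimum. Greedy $k$-means++ with parameters $k,\ell$: sample $c_1^1,\dots,c_1^\ell\in X$ independently and uniformly at random, let $c_1$ be the one minimizing $\phi(X,\{c\})$ and set $C_1=\{c_1\}$. For $i=1,\dots,k-1$: sample $c_{i+1}^1,\dots,c_{i+1}^\ell\in X$ independently, where each is equal to $x\in X$ with probability $\phi(x,C_i)/\phi(X,C_i)$; let $c_{i+1}$ be the candidate $c\in\{c_{i+1}^1,\dots,c_{i+1}^\ell\}$ minimizing $\phi(X,C_i\cup\{c\})$, and set $C_{i+1}=C_i\cup\{c_{i+1}\}$. Output $C=C_k$. Logarithms are natural. *)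

(* Defs.v *)
From mathcomp Require Import all_boot all_order all_algebra.
From mathcomp Require Import classical_sets reals exp.
Set Implicit Arguments. Unset Strict Implicit. Unset Printing Implicit Defensive.
Import Order.TTheory GRing.Theory Num.Theory.
Local Open Scope ring_scope.

Section KMeans.
Variables (R : realType) (d : nat).
Notation pt := 'rV[R]_d.

Definition dist2 (x c : pt) : R := \sum_(i < d) (x 0 i - c 0 i) ^+ 2.

(* phi(x, C) = min_{c in C} ||x - c||^2  (only used for nonempty C; 0 on [::]) *)
Definition phi_pt (x : pt) (C : seq pt) : R :=
  match C with
  | [::] => 0
  | c :: cs => foldl (fun m c' => Num.min m (dist2 x c')) (dist2 x c) cs
  end.

Definition phi (X C : seq pt) : R := \sum_(x <- X) phi_pt x C.

(* OPT_k(X) = min over C subset R^d with |C| = k of phi(X, C)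
   (stated as the infimum; the minimum is attained). *)
Definition OPTk (X : seq pt) (k : nat) : R :=
  inf [set phi X C | C in [set C : seq pt | uniq C /\ size C = k]].

(* Sampling probability of index idx (a point of X) given current centers C:
   uniform if C is empty (first step); D^2-sampling otherwise.
   Degenerate case phi(X,C) = 0 (all points already centers): uniform. *)
Definition prob (X C : seq pt) (idx : nat) : R :=
  if C is [::] then (size X)%:R^-1
  else if phi X C == 0 then (size X)%:R^-1
  else phi_pt (nth 0 X idx) C / phi X C.

Definition best (X C : seq pt) (s : seq pt) : pt :=
  let cost c := phi X (rcons C c) in
  foldl (fun b c => if cost c < cost b then c else b) (head 0 s) (behead s).

(* Expected value of phi(X, C_final) when performing i more greedy
   k-means++ steps (each with l independent candidates) from centers C. *)
Fixpoint greedy_exp (X : seq pt) (l : nat) (i : nat) (C : seq pt) : R :=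
  match i with
  | 0 => phi X C
  | i'.+1 =>
      \sum_(f : {ffun 'I_l -> 'I_(size X)})
        (\prod_(j < l) prob X C (f j)) *
        greedy_exp X l i' (rcons C (best X C [seq nth 0 X (f j) | j <- enum 'I_l]))
  end.

Definition greedy_kmeanspp_expected_cost (X : seq pt) (k l : nat) : R :=
  greedy_exp X l k [::].

End KMeans.

(* Main.v *)
(* Fix k comparison centres and the clusters K they induce. A cluster is active
   while no centre has been taken from it and its cost exceeds 2048 times its
   optimal cost opt K; let A and B be the total costs of the inactive and of the
   active clusters, and u the number of active ones.

   A chosen candidate is a given point with probability at most l times its
   D^2-probability. Hence a step is wasted on an inactive cluster with probability
   at most l A / (A + B), and, with r steps to go, the excess of u over r is charged
   the mean active cost B / u; comparing the chosen candidate with the first one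
   shows that this mean grows only by terms of order A / u and of order
   sum_K opt K * p_K, where p_K is the D^2-probability of K. The harmonic sum over
   the steps gives a factor l log k, and A itself grows by at most
   O(l) * sum_K opt K * p_K per step.

   So everything reduces to E[sum over steps of p_K] = O(l log^2 k) for one active
   cluster K. Let R be a power of 16 approximating the squared distance of the
   centre of K to the chosen centres, and N1 >= N2 the numbers of points within
   R / 16 and R / 256 of it. Either candidates whose gain is at least about N2 * R
   are drawn with constant probability, and then the total cost drops by that amount;
   or they are rare, and then a candidate from K is likely to be chosen once drawn.
   The potential pot of K combines log (cost / (N2 R)), truncated at O(log k) and
   weighted by |K| / N2, with a term -l log^2 k * |K| / N1. When R drops, the first
   part may go back to log k, but the second pays for it unless the new centre is
   among the outermost fraction delta ~ 1 / (l log k) of the N1 points, which is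
   unlikely enough to be absorbed. *)
Require Import Defs.
From mathcomp Require Import all_boot all_order all_algebra.
From mathcomp Require Import classical_sets reals sequences exp.
From mathcomp Require Import ring lra.
Import Order.TTheory GRing.Theory Num.Theory.
Local Open Scope ring_scope.

Set Implicit Arguments. Unset Strict Implicit. Unset Printing Implicit Defensive.

(** * Squared distances, costs and the greedy choice of a candidate *)

Section SquaredDistance.
Variables (R : realType) (d : nat).
Implicit Types (x y z c : 'rV[R]_d) (C X : seq 'rV[R]_d).

Lemma dist2_ge0 x c : 0 <= dist2 x c.
Proof. by apply: sumr_ge0 => i _; rewrite sqr_ge0. Qed.

Lemma dist2C x y : dist2 x y = dist2 y x.
Proof. by apply: eq_bigr => i _; rewrite -sqrrN opprB. Qed.

(** In each coordinate the right side minus the left side is the square of [a + b - 2 * c]. *)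
Lemma dist2_tri x y z : dist2 x y <= 2 * dist2 x z + 2 * dist2 z y.
Proof.
rewrite /dist2 !mulr_sumr -big_split/=; apply: ler_sum => i _.
by rewrite -subr_ge0; set a := x 0 i; set b := y 0 i; set c := z 0 i;
  rewrite (_ : _ - _ = (a + b - 2 * c) ^+ 2) ?sqr_ge0//; ring.
Qed.

Lemma phi_pt_rcons x C c :
  C != [::] -> phi_pt x (rcons C c) = Num.min (phi_pt x C) (dist2 x c).
Proof. by case: C => //= a s _; rewrite -cats1 foldl_cat. Qed.

Lemma phi_pt_le x C c : c \in C -> phi_pt x C <= dist2 x c.
Proof.
elim/last_ind: C => // s a IH; rewrite mem_rcons inE.
case: (eqVneq s [::]) => [->|s0]; first by rewrite in_nil orbF => /eqP->.
rewrite phi_pt_rcons// ge_min => /orP[/eqP->|/IH->]//.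
by rewrite lexx orbT.
Qed.

Lemma phi_pt_attained x C :
  C != [::] -> exists2 c, c \in C & phi_pt x C = dist2 x c.
Proof.
elim/last_ind: C => // s a IH _.
case: (eqVneq s [::]) => [->|s0]; first by exists a; rewrite ?inE.
rewrite phi_pt_rcons//; have [c cs e] := IH s0.
rewrite minEle; case: ifP => _.
  by exists c => //; rewrite mem_rcons inE cs orbT.
by exists a => //; rewrite mem_rcons inE eqxx.
Qed.

Lemma phi_pt_ge0 x C : 0 <= phi_pt x C.
Proof.
case: (eqVneq C [::]) => [->//|/(phi_pt_attained x)[c _ ->]].
exact: dist2_ge0.
Qed.

Lemma phi_pt_tri x y C :
  C != [::] -> phi_pt x C <= 2 * dist2 x y + 2 * phi_pt y C.
Proof.
move=> C0; have [c cC ->] := phi_pt_attained y C0.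
exact: le_trans (phi_pt_le x cC) (dist2_tri _ _ _).
Qed.

Lemma phi_pt_rcons_le x C c :
  C != [::] -> phi_pt x (rcons C c) <= phi_pt x C.
Proof. by move=> C0; rewrite phi_pt_rcons// ge_min lexx. Qed.

Lemma phi_ge0 X C : 0 <= phi X C.
Proof. by apply: sumr_ge0 => x _; exact: phi_pt_ge0. Qed.

Lemma phi_rcons_le X C c : C != [::] -> phi X (rcons C c) <= phi X C.
Proof. by move=> C0; apply: ler_sum => x _; exact: phi_pt_rcons_le. Qed.

(** Adding centres never raises the cost. This settles the degenerate states, where centres exist
    but [prob] is uniform. *)
Lemma greedy_exp_phi0 X l i C :
  C != [::] -> phi X C = 0 -> greedy_exp X l i C = 0.
Proof.
elim: i C => [//|i IH] C C0 p0 /=.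
apply: big1 => f _; rewrite IH ?mulr0//; first by case: (C).
by apply/eqP; rewrite eq_le phi_ge0 -p0 phi_rcons_le.
Qed.

(** All that is used later about the fold in [best]. For [l = 0] the fold would return the default
    point 0, hence the hypothesis. *)
Lemma best_codom X C (l n : nat) (P : 'I_n -> 'rV[R]_d) (f : 'I_l -> 'I_n) :
  (0 < l)%N -> exists i, [/\ best X C [seq P (f j) | j <- enum 'I_l] = P i,
    [exists j, f j == i] &
    forall j, phi X (rcons C (P i)) <= phi X (rcons C (P (f j)))].
Proof.
move=> l0; pose cost c := phi X (rcons C c).
have F (s : seq 'rV[R]_d) b : let r := foldl (fun b c => if cost c < cost b then c else b) b s in
   r \in b :: s /\ forall c, c \in b :: s -> cost r <= cost c.
  elim: s b => [|a s IH] b /=; first by rewrite inE; split=> // c; rewrite inE => /eqP->.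
  case: ifP => h; have [h1 h2] := IH (if cost a < cost b then a else b); rewrite h in h1 h2.
    split; first by rewrite inE h1 orbT.
    move=> c; rewrite inE => /orP[/eqP->|/h2//].
    by apply: le_trans (ltW h); apply: h2; rewrite mem_head.
  split; first by move: h1; rewrite !inE => /orP[->//|->]; rewrite !orbT.
  move=> c; rewrite !inE => /or3P[/eqP->|/eqP->|cs].
  - by apply: h2; rewrite mem_head.
  - by apply: (le_trans (h2 b (mem_head _ _))); rewrite leNgt h.
  - by apply: h2; rewrite inE cs orbT.
rewrite /best; set s := [seq _ | _ <- _].
have ss : head 0 s :: behead s = s.
  have : size s != 0%N by rewrite size_map size_enum_ord -lt0n.
  by case: (s).
have [] := F (behead s) (head 0 s); rewrite -/(cost) ss.
set r := foldl _ _ _ => /mapP[j _ rj] h.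
exists (f j); split => //; first by apply/existsP; exists j.
move=> j'; rewrite -rj; apply: h; apply/mapP; exists j' => //.
by rewrite mem_enum.
Qed.

End SquaredDistance.

(** * The best of [l] independent draws *)

Section Sampling.
Variables (R : realType) (n l : nat) (w cst : 'I_n -> R).
Variable ch : {ffun 'I_l -> 'I_n} -> 'I_n.
Hypothesis l_gt0 : (0 < l)%N.
Hypothesis w_ge0 : forall i, 0 <= w i.
Hypothesis w_sum1 : \sum_i w i = 1.
Hypothesis ch_codom : forall f : {ffun 'I_l -> 'I_n}, [exists j, f j == ch f].
Hypothesis ch_min : forall (f : {ffun 'I_l -> 'I_n}) j, cst (ch f) <= cst (f j).

(** Expectation of [g] at the index that the rule [ch] picks from [l] independent draws with law
    [w]. *)
Definition Ech (g : 'I_n -> R) : R :=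
  \sum_(f : {ffun 'I_l -> 'I_n}) (\prod_(j < l) w (f j)) * g (ch f).

Lemma sample_prod (F : 'I_l -> 'I_n -> R) :
  \sum_(f : {ffun 'I_l -> 'I_n}) (\prod_(j < l) w (f j)) * (\prod_(j < l) F j (f j))
  = \prod_(j < l) \sum_i w i * F j i.
Proof.
by rewrite bigA_distr_bigA/=; apply: eq_bigr => f _; rewrite big_split.
Qed.

Lemma sample_ge0 (f : {ffun 'I_l -> 'I_n}) : 0 <= \prod_(j < l) w (f j).
Proof. by apply: prodr_ge0. Qed.

Lemma sample_all (v : 'I_n -> R) :
  \sum_(f : {ffun 'I_l -> 'I_n}) (\prod_(j < l) w (f j)) * (\prod_(j < l) v (f j))
  = (\sum_i w i * v i) ^+ l.
Proof. by rewrite (sample_prod (fun=> v)) prodr_const card_ord. Qed.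

Lemma sample_marginal j0 (g : 'I_n -> R) :
  \sum_(f : {ffun 'I_l -> 'I_n}) (\prod_(j < l) w (f j)) * g (f j0)
  = \sum_i w i * g i.
Proof.
have := sample_prod (fun j i => if j == j0 then g i else 1).
rewrite [RHS](bigD1 j0)//= eqxx [X in _ * X]big1; last first.
  by move=> j /negPf->; rewrite -[RHS]w_sum1; apply: eq_bigr => i _; rewrite mulr1.
rewrite mulr1 => <-; apply: eq_bigr => f _; congr (_ * _).
by rewrite (bigD1 j0)//= eqxx big1 ?mulr1// => j /negPf->.
Qed.

Lemma Ech_le g1 g2 : (forall i, g1 i <= g2 i) -> Ech g1 <= Ech g2.
Proof. by move=> h; apply: ler_sum => f _; rewrite ler_wpM2l// sample_ge0. Qed.

Lemma EchD g1 g2 : Ech (fun i => g1 i + g2 i) = Ech g1 + Ech g2.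
Proof. by rewrite -big_split; apply: eq_bigr => f _; rewrite mulrDr. Qed.

Lemma EchZ a g : Ech (fun i => a * g i) = a * Ech g.
Proof. by rewrite /Ech mulr_sumr; apply: eq_bigr => f _; rewrite mulrCA. Qed.

Lemma Ech_cst a : Ech (fun=> a) = a.
Proof.
have := sample_all (fun=> 1).
under [X in _ = X ^+ _ -> _]eq_bigr do rewrite mulr1.
rewrite w_sum1 expr1n => h; rewrite /Ech -mulr_suml.
transitivity (1 * a); last by rewrite mul1r.
congr (_ * _). rewrite -[RHS]h.
by apply: eq_bigr => f _; rewrite [X in _ = _ * X]big1 ?mulr1.
Qed.

Lemma Ech_sum (I : finType) (p : pred I) (g : I -> 'I_n -> R) :
  Ech (fun i => \sum_(a | p a) g a i) = \sum_(a | p a) Ech (g a).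
Proof. by rewrite exchange_big; apply: eq_bigr => f _; rewrite mulr_sumr. Qed.

(** The chosen index is one of the draws, so [g] there is at most the sum of [g] over all [l] draws,
    each of law [w]. *)
Lemma Ech_union g : (forall i, 0 <= g i) -> Ech g <= l%:R * \sum_i w i * g i.
Proof.
move=> g0; apply: (@le_trans _ _ (\sum_(f : {ffun 'I_l -> 'I_n})
    (\prod_(j < l) w (f j)) * \sum_j g (f j))).
  apply: ler_sum => f _; rewrite ler_wpM2l ?sample_ge0//.
  have /existsP[j /eqP <-] := ch_codom f.
  by rewrite (bigD1 j)//= lerDl sumr_ge0.
under eq_bigr do rewrite mulr_sumr.
rewrite exchange_big/=; under eq_bigr do rewrite sample_marginal.
by rewrite sumr_const card_ord mulr_natl.
Qed.

(** The choice is no worse than the first draw, whose law is [w]; no factor [l] is lost. *)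
Lemma Ech_min : Ech cst <= \sum_i w i * cst i.
Proof.
rewrite -(sample_marginal (Ordinal l_gt0)); apply: ler_sum => f _.
by rewrite ler_wpM2l ?sample_ge0.
Qed.

(** Bernoulli's inequality for [1 + h], and (1 - h)(1 + h) <= 1. The power is the probability that
    all [l] draws miss a set of mass [h]. *)
Lemma onem_expr_le (h : R) : 0 <= h <= 1 -> (1 - h) ^+ l * (1 + l%:R * h) <= 1.
Proof.
move=> /andP[h0 h1].
have B : 1 + l%:R * h <= (1 + h) ^+ l.
  elim: (l) => [|m IH]; first by rewrite mul0r addr0.
  rewrite exprS -natr1; apply: (@le_trans _ _ ((1 + h) * (1 + m%:R * h))); last first.
    by rewrite ler_wpM2l//; lra.
  have := ler0n R m; nra.
apply: (@le_trans _ _ ((1 - h) ^+ l * (1 + h) ^+ l)).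
  by rewrite ler_wpM2l// exprn_ge0//; lra.
by rewrite -exprMn exprn_ile1//; nra.
Qed.

Lemma onem_expr_ge (h : R) m : 0 <= h <= 1 -> 1 - m%:R * h <= (1 - h) ^+ m.
Proof.
move=> /andP[h0 h1]; elim: m => [|m IH]; first by rewrite mul0r subr0 expr0.
rewrite exprS -natr1; apply: (@le_trans _ _ ((1 - h) * (1 - m%:R * h))); last first.
  by rewrite ler_wpM2l//; lra.
have := ler0n R m; nra.
Qed.

Let mass (p : pred 'I_n) : R := \sum_(i | p i) w i.

Lemma mass_ge0 p : 0 <= mass p.
Proof. exact: sumr_ge0. Qed.

Lemma mass_le1 p : mass p <= 1.
Proof. by rewrite -w_sum1 (bigID p)/= lerDl sumr_ge0. Qed.

Lemma sample_allin (p : pred 'I_n) :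
  \sum_(f : {ffun 'I_l -> 'I_n}) (\prod_(j < l) w (f j)) * [forall j, p (f j)]%:R
  = mass p ^+ l.
Proof.
rewrite /mass [in RHS]big_mkcond/=.
rewrite (eq_bigr (fun i => w i * (p i)%:R)); last first.
  by move=> i _; case: (p i); rewrite ?mulr1 ?mulr0.
rewrite -sample_all; apply: eq_bigr => f _; congr (_ * _).
have [/forallP h|/forallPn[j pj]] := boolP [forall j, p (f j)].
  by rewrite big1// => j _; rewrite h.
by rewrite (bigD1 j)//= (negPf pj) mul0r.
Qed.

Lemma massC p : mass (predC p) = 1 - mass p.
Proof. by rewrite -w_sum1 /mass [in RHS](bigID p)/= addrAC subrr add0r. Qed.

(** A single draw of cost at most [t] forces the choice to cost at most [t], and all draws fail with
    probability at most 1 / (1 + 1/2) = 2/3. *)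
Lemma Ech_heavy t : 1 / 2 <= l%:R * mass (fun i => (cst i <= t)%R) ->
  1 / 3 <= Ech (fun i => (cst i <= t)%R%:R).
Proof.
set H := fun i => _ => h; have m0 := mass_ge0 H; have m1 := mass_le1 H.
have e : (1 - mass H) ^+ l <= 2 / 3.
  have m01 : 0 <= mass H <= 1 by rewrite m0.
  have := onem_expr_le m01; have : 0 <= (1 - mass H) ^+ l by apply: exprn_ge0; lra.
  set y := _ ^+ _; nra.
suff : 1 - (1 - mass H) ^+ l <= Ech (fun i => (H i)%:R) by lra.
rewrite -massC -sample_allin -[X in X - _](Ech_cst 1) /Ech -sumrB.
apply: ler_sum => f _; rewrite -mulrBr ler_wpM2l ?sample_ge0//.
case: forallP => [_|]; first by rewrite subrr.
move=> h'; rewrite subr0; case: (boolP (H (ch f))) => // nH; case: h' => j /=.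
apply/negP => Hj; move/negP: nH; apply; exact: le_trans (ch_min f j) Hj.
Qed.

(** The tangent of the convex power function at [a] lies below its graph. *)
Lemma expr_increment (a s : R) m : 0 <= a -> 0 <= s ->
  m.+1%:R * s * a ^+ m <= (a + s) ^+ m.+1 - a ^+ m.+1.
Proof.
move=> a0 s0; elim: m => [|m IH]; first by rewrite !expr1 expr0; lra.
have h1 : 0 <= a ^+ m.+1 by exact: exprn_ge0.
have h2 : a ^+ m.+1 <= (a + s) ^+ m.+1 by rewrite lerXn2r ?nnegrE//; lra.
have h3 := ler_wpM2l a0 IH; have h4 := ler_wpM2l s0 h2.
rewrite [(a + s) ^+ m.+2]exprS [a ^+ m.+2]exprS -[m.+2%:R]natr1.
move: ((a + s) ^+ m.+1) h3 h4 => u; rewrite [a ^+ m.+1]exprS.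
move: (a ^+ m) (m.+1%:R) => y z; nra.
Qed.

(* If every draw avoids [H \ S] and some draw lands in [H], then that draw is in
   [S] and beats all draws outside [H]; so the chosen index is in [S]. *)
Lemma Ech_hit t (S : pred 'I_n) : (forall i, S i -> cst i <= t) ->
  l%:R * mass (fun i => (cst i <= t)%R) <= 1 / 2 ->
  l%:R * mass S / 2 <= Ech (fun i => (S i)%:R).
Proof.
move=> SH; set H := fun i => _ => h.
have m0 := mass_ge0 H; have m1 := mass_le1 H; have s0 := mass_ge0 S.
pose T := fun i => ~~ H i || S i.
have mT : mass T = 1 - mass H + mass S.
  rewrite -massC /mass (bigID S)/= addrC; congr (_ + _); apply: eq_bigl => i; rewrite /T /=.
    case: (boolP (S i)) => Si; rewrite ?orbT ?orbF ?andbT ?andbF//.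
    by rewrite (SH i Si : H i).
  by rewrite andb_orl andbb; case: (S i); rewrite ?andbT ?orbT ?andbF.
(* Probability that all draws avoid [H \ S], minus the probability that all avoid [H]. *)
suff : (mass T) ^+ l - (1 - mass H) ^+ l <= Ech (fun i => (S i)%:R).
  apply: le_trans; rewrite mT; case: (l) l_gt0 h => // m _ h.
  apply: le_trans (expr_increment _ _ _) => //; last by lra.
  (* With l = m + 1, the slope factor (1 - h)^m is at least 1 - m h >= 1/2. *)
  have : 1 - m%:R * mass H <= (1 - mass H) ^+ m by apply: onem_expr_ge; rewrite m0.
  have : 0 <= m.+1%:R * mass S by rewrite mulr_ge0.
  rewrite -natr1 in h *; set y := _ ^+ _; set z := _ * mass S; nra.
rewrite -massC -!sample_allin /Ech -sumrB.
apply: ler_sum => f _; rewrite -mulrBr ler_wpM2l ?sample_ge0//.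
have [/forallP hT|_] := boolP [forall j, T (f j)]; last first.
  by apply: (@le_trans _ _ 0) => //; rewrite sub0r oppr_le0.
have [_|/forallPn[j /negPn/= Hj]] := boolP [forall j, predC H (f j)].
  by rewrite subrr.
rewrite subr0; have Hc : H (ch f) := le_trans (ch_min f j) Hj.
have /existsP[j' /eqP e] := ch_codom f.
by have := hT j'; rewrite /T e Hc /= => ->.
Qed.

End Sampling.

(** * Rounding to powers of 16 *)

Section Grid.
Variable R : realType.
Implicit Types D : R.

(* The least power of 16 that is at least [D], for [D > 0]. *)
Definition grid D : R := expR (ln 16 * (Num.ceil (ln D / ln 16))%:~R).

Lemma ln16_gt0 : 0 < ln 16 :> R.
Proof. by rewrite ln_gt0//; lra. Qed.

Lemma grid_gt0 D : 0 < grid D.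
Proof. exact: expR_gt0. Qed.

Lemma grid_ge D : 0 < D -> D <= grid D.
Proof.
move=> D0; rewrite -[D in D <= _]lnK ?posrE// ler_expR mulrC -ler_pdivrMr ?ln16_gt0//.
exact: ceil_ge.
Qed.

Lemma grid_lt D : 0 < D -> grid D / 16 < D.
Proof.
move=> D0; rewrite -[D in _ < D]lnK ?posrE// ltr_pdivrMr; last by lra.
rewrite -[X in _ < _ * X]lnK; last by rewrite posrE; lra.
rewrite -expRD ltr_expR -[X in _ < _ + X]mulr1 -ltrBlDr -mulrBr mulrC.
rewrite -ltr_pdivlMr ?ln16_gt0//.
by have := ceilB1_lt (ln D / ln 16); rewrite intrB.
Qed.

Lemma grid_le D D' : 0 < D' -> D' <= D -> grid D' <= grid D.
Proof.
move=> D'0 le; rewrite ler_expR ler_pM2l ?ln16_gt0// ler_int.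
apply: le_ceil.
by rewrite ler_pM2r ?invr_gt0 ?ln16_gt0// ler_ln ?posrE// (lt_le_trans D'0).
Qed.

(** Distinct powers of 16 differ by a factor of at least 16. *)
Lemma grid_lt_le16 D D' : 0 < D' -> 0 < D -> grid D' < grid D -> grid D' <= grid D / 16.
Proof.
move=> D'0 D0; rewrite ltr_expR ltr_pM2l ?ln16_gt0// ltr_int => lt.
rewrite ler_pdivlMr; last by lra.
rewrite -[X in _ * X <= _]lnK; last by rewrite posrE; lra.
rewrite -expRD ler_expR -[X in _ + X <= _]mulr1 -mulrDr ler_pM2l ?ln16_gt0//.
by have := lt; rewrite -lezD1 -(ler_int R) intrD.
Qed.

End Grid.

(** * Geometry of the clusters *)

Section Clusters.
Variables (R : realType) (d n k : nat) (P : 'I_n -> 'rV[R]_d).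
Variables (a : 'I_n -> 'I_k) (cs : 'I_k -> 'rV[R]_d).
Implicit Types (C : seq 'rV[R]_d) (K : 'I_k) (i : 'I_n).

Definition Phi C : R := \sum_i phi_pt (P i) C.
Definition cost K C : R := \sum_(i | a i == K) phi_pt (P i) C.
Definition opt K : R := \sum_(i | a i == K) dist2 (P i) (cs K).
Definition hit K C := [exists i, (a i == K) && (P i \in C)].
Definition act K C := ~~ hit K C && (2048 * opt K < cost K C).
Definition kap K : R := \sum_(i | a i == K) 1.
(** Points of all clusters are counted, not only those of [K]. *)
Definition cnt K (rho : R) : R := \sum_(i | (dist2 (P i) (cs K) <= rho)%R) 1.
Definition scale K C : R := grid (phi_pt (cs K) C).

Lemma sum_sub (p q : pred 'I_n) (F : 'I_n -> R) :
  (forall i, p i -> q i) -> (forall i, 0 <= F i) ->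
  \sum_(i | p i) F i <= \sum_(i | q i) F i.
Proof.
move=> pq F0; rewrite [X in _ <= X](bigID p)/=.
rewrite (eq_bigl p) => [|i]; first by rewrite lerDl sumr_ge0.
by case: (boolP (p i)) => [/pq->|]; rewrite ?andbF.
Qed.

Lemma Phi_cost C : Phi C = \sum_K cost K C.
Proof. exact: (partition_big a xpredT). Qed.

Lemma cost_ge0 K C : 0 <= cost K C.
Proof. by apply: sumr_ge0 => i _; exact: phi_pt_ge0. Qed.

Lemma opt_ge0 K : 0 <= opt K.
Proof. by apply: sumr_ge0 => i _; exact: dist2_ge0. Qed.

Lemma kap_ge0 K : 0 <= kap K.
Proof. by apply: sumr_ge0. Qed.

Lemma cost_rcons_le K C c : C != [::] -> cost K (rcons C c) <= cost K C.
Proof. by move=> C0; apply: ler_sum => x _; exact: phi_pt_rcons_le. Qed.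

Lemma hit_rcons K C i : injective P -> hit K (rcons C (P i)) = hit K C || (a i == K).
Proof.
move=> Pinj; apply/existsP/orP => [[j /andP[aj]]|[/existsP[j /andP[aj jC]]|ai]].
- rewrite mem_rcons inE => /orP[/eqP/Pinj <-|jC]; first by right.
  by left; apply/existsP; exists j; rewrite aj.
- by exists j; rewrite aj mem_rcons inE jC orbT.
- by exists i; rewrite ai mem_rcons mem_head.
Qed.

Lemma act_rcons K C i : injective P -> C != [::] ->
  act K (rcons C (P i)) -> act K C /\ (a i != K).
Proof.
move=> Pinj C0 /andP[]; rewrite hit_rcons// negb_or => /andP[h ->] lt.
by split => //; rewrite /act h (lt_le_trans lt)// cost_rcons_le.
Qed.

(** Each distance is split at [cs K]; either half sums to [2 * kap K * opt K]. *)
Lemma intra_dist2 K :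
  \sum_(i | a i == K) \sum_(j | a j == K) dist2 (P j) (P i) <= 4 * kap K * opt K.
Proof.
apply: (@le_trans _ _ (\sum_(i | a i == K) \sum_(j | a j == K)
    (2 * dist2 (P j) (cs K) + 2 * dist2 (P i) (cs K)))).
  apply: ler_sum => i _; apply: ler_sum => j _.
  by rewrite [dist2 (P i) _]dist2C; exact: dist2_tri.
under eq_bigr do rewrite big_split/= -mulr_sumr -/(opt K).
rewrite big_split/=.
have -> : \sum_(i | a i == K) \sum_(j | a j == K) 2 * dist2 (P i) (cs K)
   = kap K * (2 * opt K).
  rewrite exchange_big/= /kap mulr_suml; apply: eq_bigr => i _.
  by rewrite mul1r mulr_sumr.
have -> : \sum_(i | a i == K) (2 * opt K) = kap K * (2 * opt K).
  by rewrite /kap mulr_suml; apply: eq_bigr => i _; rewrite mul1r.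
by rewrite [leRHS](_ : _ = kap K * (2 * opt K) + kap K * (2 * opt K))//; ring.
Qed.

(** Divided by [cost K C], this is the classical k-means++ estimate: a D^2-sample from [K] leaves
    [K] with expected cost at most [16 * opt K]. *)
Lemma hit_cost K C : C != [::] ->
  \sum_(i | a i == K) phi_pt (P i) C * cost K (rcons C (P i))
  <= 16 * opt K * cost K C.
Proof.
move=> C0; have [k0|k0] := eqVneq (kap K) 0.
  rewrite big1 => [|i ai].
    by rewrite !mulr_ge0 ?opt_ge0 ?cost_ge0.
  by move: k0; rewrite /kap (bigD1 i)//= => /eqP; rewrite gt_eqF// ltr_pwDl ?sumr_ge0.
have kp : 0 < kap K by rewrite lt_def k0 kap_ge0.
rewrite -(ler_pM2l kp) mulr_sumr.
apply: (@le_trans _ _ (\sum_(i | a i == K) 4 * (\sum_(j | a j == K) dist2 (P j) (P i)) * cost K C)).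
  apply: ler_sum => i ai; set s := \sum_(j | _) _.
  have c1 := cost_rcons_le K (P i) C0.
  have c2 : cost K (rcons C (P i)) <= s.
    by apply: ler_sum => j _; apply: phi_pt_le; rewrite mem_rcons mem_head.
  have c3 : kap K * phi_pt (P i) C <= 2 * s + 2 * cost K C.
    rewrite /kap mulr_suml /s /cost !mulr_sumr -big_split/=.
    by apply: ler_sum => j _; rewrite mul1r dist2C; exact: phi_pt_tri.
  have c4 := cost_ge0 K (rcons C (P i)); have c5 := cost_ge0 K C.
  have s0 : 0 <= s by apply: sumr_ge0 => j _; exact: dist2_ge0.
  rewrite mulrA; apply: le_trans (ler_wpM2r c4 c3) _.
  (* The new cost is bounded by the old one where it multiplies [2 * s], and by [s] where it
     multiplies [2 * cost K C]. *)
  by have := ler_wpM2l s0 c1; have := ler_wpM2l c5 c2; nra.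
rewrite -mulr_suml -mulr_sumr.
have := intra_dist2 K; set s := \sum_(i | _) _ => h.
have := cost_ge0 K C; nra.
Qed.

Section Active.
Variables (C : seq 'rV[R]_d) (K : 'I_k).
Hypotheses (C0 : C != [::]) (hact : act K C).
Let D := phi_pt (cs K) C.
Let Dt := scale K C.

Lemma cost_le : cost K C <= 2 * opt K + 2 * kap K * D.
Proof.
rewrite /cost /opt /kap mulr_sumr mulr_sumr mulr_suml -big_split/=.
by apply: ler_sum => i _; rewrite mulr1; exact: phi_pt_tri.
Qed.

Lemma act_opt : 2048 * opt K < cost K C.
Proof. by case/andP: hact. Qed.

Lemma act_kapD_gt0 : 0 < kap K * D.
Proof. have := cost_le; have := act_opt; have := opt_ge0 K; lra. Qed.

Lemma act_dist_gt0 : 0 < D.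
Proof.
by rewrite lt_def phi_pt_ge0 andbT; apply: contraTneq act_kapD_gt0 => ->; rewrite mulr0 ltxx.
Qed.

Lemma act_kap_gt0 : 0 < kap K.
Proof. by move: act_kapD_gt0; rewrite pmulr_lgt0 ?act_dist_gt0. Qed.

Lemma scale_gt0 : 0 < Dt.
Proof. exact: grid_gt0. Qed.

Lemma scale_ge : D <= Dt.
Proof. exact/grid_ge/act_dist_gt0. Qed.

Lemma scale_lt : Dt / 16 < D.
Proof. exact/grid_lt/act_dist_gt0. Qed.

Lemma act_cost : cost K C <= 4 * (kap K * Dt).
Proof.
have := cost_le; have := act_opt; have := opt_ge0 K.
have := ler_wpM2l (kap_ge0 K) scale_ge; lra.
Qed.

(** Markov's inequality: the q points farther out contribute at least q Dt / 256 to [opt K], while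
    activity gives [opt K] < 4 kap Dt / 2048 = kap Dt / 512. So at least half of an active cluster
    lies in its core. *)
Lemma act_core :
  kap K / 2 <= \sum_(i | (a i == K) && (dist2 (P i) (cs K) <= Dt / 256)%R) 1.
Proof.
have := act_cost; have := act_opt; have Dt0 := scale_gt0.
rewrite /kap [X in _ <= 4 * (X * _) -> _](bigID (fun i => (dist2 (P i) (cs K) <= Dt / 256)%R))/=.
rewrite [X in _ -> _ -> X / 2 <= _](bigID (fun i => (dist2 (P i) (cs K) <= Dt / 256)%R))/=.
set p := \sum_(i | _) _; set q := \sum_(i | _ && ~~ _) _ => h1 h2.
have : q * (Dt / 256) <= opt K.
  rewrite /q mulr_suml; apply: (@le_trans _ _ (\sum_(i | (a i == K) &&
    ~~ (dist2 (P i) (cs K) <= Dt / 256)%R) dist2 (P i) (cs K))).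
    by apply: ler_sum => i /andP[_]; rewrite -ltNge mul1r => /ltW.
  by apply: sum_sub => [i /andP[]//|i]; exact: dist2_ge0.
move=> h3; have h4 : (q - p) * Dt <= 0 by nra.
by move: h4; rewrite pmulr_lle0//; lra.
Qed.

Lemma act_cnt : kap K / 2 <= cnt K (Dt / 256).
Proof. by apply: (le_trans act_core); apply: sum_sub => // i /andP[]. Qed.

(** Here 7/256 = 1/32 - 1/256: half of D > Dt / 16, less the distance to [cs K]. *)
Lemma core_phi i : dist2 (P i) (cs K) <= Dt / 256 -> 7 / 256 * Dt <= phi_pt (P i) C.
Proof.
move=> h; have := phi_pt_tri (cs K) (P i) C0; rewrite dist2C -/D.
have := scale_lt; lra.
Qed.

Lemma ball_phi i : dist2 (P i) (cs K) <= Dt / 16 -> phi_pt (P i) C <= 4 * Dt.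
Proof.
move=> h; have := phi_pt_tri (P i) (cs K) C0; rewrite -/D.
have := scale_ge; have := scale_gt0; lra.
Qed.

(** Every point within Dt / 256 of [cs K], of whatever cluster, paid at least 7/256 Dt and now pays
    at most (2 + 2)/256 Dt. *)
Lemma core_drop i : dist2 (P i) (cs K) <= Dt / 256 ->
  Phi (rcons C (P i)) <= Phi C - 3 / 256 * cnt K (Dt / 256) * Dt.
Proof.
move=> h; rewrite lerBrDl addrC -lerBrDl /Phi -sumrB /cnt mulr_sumr mulr_suml.
rewrite big_mkcond/=; apply: ler_sum => j _; case: ifP => hj; last first.
  by rewrite subr_ge0 phi_pt_rcons_le.
have := core_phi hj; have : phi_pt (P j) (rcons C (P i)) <= dist2 (P j) (P i).
  by apply: phi_pt_le; rewrite mem_rcons mem_head.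
have := dist2_tri (P j) (P i) (cs K); rewrite [dist2 (cs K) _]dist2C.
by move: (scale_gt0) => ?; lra.
Qed.

Lemma act_Phi_ge : 7 / 256 * cnt K (Dt / 256) * Dt <= Phi C.
Proof.
rewrite /cnt mulr_sumr mulr_suml /Phi big_mkcond/=; apply: ler_sum => i _.
case: ifP => h; last exact: phi_pt_ge0.
by rewrite mulr1; exact: core_phi.
Qed.

End Active.
End Clusters.

(** Take an innermost one of the counted points. More than (1 - delta) N points are strictly closer
    than it; they lie in the ball and none of them is counted. *)
Lemma outermost_count (R : realType) (n : nat) (dist : 'I_n -> R) (rho delta : R) :
  let N := \sum_(i | (dist i <= rho)%R) 1 in 0 <= delta ->
  \sum_(i | (dist i <= rho)%R && ((1 - delta) * N < \sum_(j | (dist j < dist i)%R) 1)%R) 1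
  <= delta * N :> R.
Proof.
move=> N delta0; pose T i := (dist i <= rho)%R &&
  ((1 - delta) * N < \sum_(j | (dist j < dist i)%R) 1)%R.
rewrite -[leLHS]/(\sum_(i | T i) 1).
have N0 : 0 <= N by apply: sumr_ge0.
case: (pickP T) => [i0 Ti0|T0]; last by rewrite big_pred0// mulr_ge0.
case: (Order.TotalTheory.arg_minP dist Ti0) => i /andP[di Ti] imin.
suff : \sum_(j | T j) 1 + \sum_(j | (dist j < dist i)%R) 1 <= N :> R by lra.
have -> : N = \sum_(j | (dist j <= rho)%R && ~~ (dist j < dist i)%R) 1
  + \sum_(j | (dist j <= rho)%R && (dist j < dist i)%R) 1.
  by rewrite /N (bigID (fun j => (dist j < dist i)%R))/= addrC.
apply: lerD; apply: sum_sub => // j.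
  by move=> Tj; rewrite -leNgt (imin _ Tj) andbT; case/andP: Tj.
by move=> lt; rewrite lt andbT (le_trans (ltW lt)).
Qed.

(** * The potential of one active cluster and its change in a step *)

Section Potential.
Variables (R : realType) (d n k l : nat) (P : 'I_n -> 'rV[R]_d).
Variables (a : 'I_n -> 'I_k) (cs : 'I_k -> 'rV[R]_d) (L : R).
Hypothesis P_inj : injective P.
Hypothesis l_gt0 : (0 < l)%N.
Hypothesis L_ge1 : 1 <= L.
Hypothesis L_expk : k%:R <= expR L.
Implicit Types (C : seq 'rV[R]_d) (K : 'I_k) (i : 'I_n).

Local Notation Phi := (Phi P).
Local Notation cost := (cost P a).
Local Notation opt := (opt P a cs).
Local Notation act := (act P a cs).
Local Notation kap := (@kap R n k a).
Local Notation cnt := (cnt P cs).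
Local Notation scale := (scale cs).

(** Chosen so that 16 l L delta = 1/512, which is what [E_top] needs. *)
Definition delta : R := (8192 * l%:R * L)^-1.
(* If [scale] changes, then the new centre lies in the ball counted by [N1], and the
   new such ball is contained in the old ball counted by [N2]. *)
Definition N1 K C := cnt K (scale K C / 16).
Definition N2 K C := cnt K (scale K C / 256).
(** The denominator is the lower bound for [Phi C] given by [act_Phi_ge], so on active clusters
    [excess] is at least 1. *)
Definition excess K C := Phi C / (7 / 256 * N2 K C * scale K C).
(** Above the truncation, [excess] exceeds [k] and [share] is O(1/k), small enough to be given away
    in every step. *)
Definition lev K C := Num.min L (ln (excess K C)).
(** The weight [kap K / N2 K C] turns a relative drop of order N2 scale / Phi of the total cost into
    a gain of order [share]. The constant terms keep [pot] at least 2, as both quotients are at most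
    2. *)
Definition pot K C : R :=
  2 + 2 * L + 4 * (L / delta) - (L - lev K C) * (kap K / N2 K C)
  - 2 * (L / delta) * (kap K / N1 K C).

(** Up to a constant, an upper bound for the D^2-probability of an active [K]; see [cost_share]. *)
Definition share K C : R := kap K * scale K C / Phi C.
Definition outer K C i := (dist2 (P i) (cs K) <= scale K C / 16)%R &&
  ((1 - delta) * N1 K C < \sum_(j | (dist2 (P j) (cs K) < dist2 (P i) (cs K))%R) 1)%R.
(** The only centres that can shrink [scale] without shrinking [N1] by the factor [1 - delta]. If
    [N1] exceeds [2 * N2], it shrinks anyway, since the new [N1] is at most the old [N2]. *)
Definition top K C i := outer K C i && (N1 K C <= 2 * N2 K C)%R.

Lemma delta_gt0 : 0 < delta.
Proof.
by rewrite invr_gt0 !mulr_gt0 ?ltr0n// (lt_le_trans ltr01).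
Qed.

Lemma delta_le : delta <= 1 / 2.
Proof.
rewrite /delta mul1r lef_pV2 ?posrE; first last.
- by lra.
- by rewrite !mulr_gt0 ?ltr0n// (lt_le_trans ltr01).
have l1 : 1 <= l%:R :> R by rewrite ler1n.
by have := ler_pM ler01 ler01 l1 L_ge1; lra.
Qed.

Lemma cnt_le K (r r' : R) : r <= r' -> cnt K r <= cnt K r'.
Proof. by move=> rr'; apply: sum_sub => // i h; exact: le_trans h rr'. Qed.

Section Step.
Variables (C : seq 'rV[R]_d) (K : 'I_k).
Hypotheses (C0 : C != [::]) (hact : act K C).

Lemma kap_gt0 : 0 < kap K.
Proof. exact: act_kap_gt0 C0 hact. Qed.

Lemma N2_ge : kap K / 2 <= N2 K C.
Proof. exact: (act_cnt C0 hact). Qed.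

Lemma N2_gt0 : 0 < N2 K C.
Proof. by have := N2_ge; have := kap_gt0; lra. Qed.

Lemma N2_le_N1 : N2 K C <= N1 K C.
Proof. by apply: cnt_le; have := scale_gt0 cs C K; lra. Qed.

Lemma N1_gt0 : 0 < N1 K C.
Proof. exact: lt_le_trans N2_gt0 N2_le_N1. Qed.

Lemma kapN2_gt0 : 0 < kap K / N2 K C.
Proof. by rewrite divr_gt0 ?kap_gt0 ?N2_gt0. Qed.

Lemma kapN2_le : kap K / N2 K C <= 2.
Proof. by rewrite ler_pdivrMr ?N2_gt0//; have := N2_ge; lra. Qed.

Lemma kapN1_gt0 : 0 < kap K / N1 K C.
Proof. by rewrite divr_gt0 ?kap_gt0 ?N1_gt0. Qed.

Lemma kapN1_le : kap K / N1 K C <= kap K / N2 K C.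
Proof.
by rewrite ler_wpM2l ?kap_ge0// lef_pV2 ?posrE ?N1_gt0 ?N2_gt0// N2_le_N1.
Qed.

Lemma ball_gt0 : 0 < 7 / 256 * N2 K C * scale K C.
Proof. by rewrite !mulr_gt0 ?N2_gt0 ?scale_gt0//; lra. Qed.

Lemma act_Phi_gt0 : 0 < Phi C.
Proof. exact: lt_le_trans ball_gt0 (act_Phi_ge C0 hact). Qed.

Lemma excess_ge1 : 1 <= excess K C.
Proof. by rewrite ler_pdivlMr ?ball_gt0// mul1r; exact: (act_Phi_ge C0 hact). Qed.

Lemma lev_ge0 : 0 <= lev K C.
Proof. by rewrite le_min (le_trans ler01 L_ge1) ln_ge0// excess_ge1. Qed.

Lemma lev_le : lev K C <= L.
Proof. by rewrite ge_min lexx. Qed.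

Lemma Ldelta_gt0 : 0 < L / delta.
Proof. by rewrite divr_gt0 ?delta_gt0// (lt_le_trans ltr01). Qed.

(** The value 2 lets a cluster that becomes inactive, and so loses all of [pot], pay for [leaves] on
    both sides of [next_le]. *)
Lemma pot_ge2 : 2 <= pot K C.
Proof.
rewrite /pot; have := kapN2_le; have := kapN1_le; have := kapN1_gt0.
have := lev_ge0; have := lev_le; have := Ldelta_gt0; have := kapN2_gt0.
move: (kap K / N2 K C) (kap K / N1 K C) (L / delta) (lev K C) => x y z f.
move=> *; have h1 : (L - f) * x <= L * 2 by nra.
have h2 : z * y <= z * 2 by nra.
lra.
Qed.

Lemma pot_le : pot K C <= 2 + 2 * L + 4 * (L / delta).
Proof.
rewrite /pot.
have h1 : 0 <= (L - lev K C) * (kap K / N2 K C).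
  by rewrite mulr_ge0 ?(ltW kapN2_gt0)// subr_ge0 lev_le.
have h2 : 0 <= 2 * (L / delta) * (kap K / N1 K C).
  apply: mulr_ge0; last exact: ltW kapN1_gt0.
  by apply: mulr_ge0 => //; exact: ltW Ldelta_gt0.
lra.
Qed.

Lemma share_ge0 : 0 <= share K C.
Proof. by rewrite !mulr_ge0 ?kap_ge0 ?ltW ?scale_gt0 ?invr_gt0 ?act_Phi_gt0. Qed.

Lemma cost_share : cost K C / Phi C <= 4 * share K C.
Proof.
rewrite /share mulrA ler_pM2r ?invr_gt0 ?act_Phi_gt0//.
exact: (act_cost C0 hact).
Qed.

Lemma share_le : 7 / 256 * share K C <= kap K / N2 K C.
Proof.
rewrite ler_pdivlMr ?N2_gt0// /share.
rewrite [leLHS](_ : _ = kap K * (7 / 256 * N2 K C * scale K C) / Phi C); last by ring.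
by rewrite ler_pdivrMr ?act_Phi_gt0// ler_pM2l ?kap_gt0//; exact: (act_Phi_ge C0 hact).
Qed.

Lemma rcons_neq0 i : rcons C (P i) != [::].
Proof. by case: (C). Qed.

(** If [scale] changes, then [P i] is the chosen centre nearest to [cs K], and the new ball of [N1]
    holds only points strictly closer to [cs K] than [P i]. So if [N1] hardly shrinks, [P i] is
    among the outermost points. *)
Lemma scale_cases i (C' := rcons C (P i)) : act K C' ->
  scale K C' = scale K C \/ (scale K C' <= scale K C / 16 /\
    (N1 K C' <= (1 - delta) * N1 K C \/ top K C i)).
Proof.
move=> hact'; have D'0 := act_dist_gt0 (rcons_neq0 i) hact'.
have D0 := act_dist_gt0 C0 hact.
have le := grid_le D'0 (phi_pt_rcons_le (cs K) (P i) C0).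
have [e|ne] := eqVneq (scale K C') (scale K C); [by left|right].
have lt : scale K C' < scale K C by rewrite lt_neqAle ne.
have s16 : scale K C' <= scale K C / 16 := grid_lt_le16 D'0 D0 lt; split => //.
have e : phi_pt (cs K) C' = dist2 (P i) (cs K).
  rewrite /C' phi_pt_rcons// minEle [dist2 (P i) _]dist2C; case: ifP => // h.
  move: lt; rewrite /scale /C' phi_pt_rcons// minEle h ltxx //.
have [h|h] := leP (N1 K C') ((1 - delta) * N1 K C); [by left|right].
apply/andP; split.
  apply/andP; split.
    by rewrite -e; apply: le_trans s16; exact: scale_ge (rcons_neq0 i) hact'.
  apply: (lt_le_trans h); apply: sum_sub => // j hj.
  by rewrite -e; apply: le_lt_trans hj _; exact: scale_lt (rcons_neq0 i) hact'.
have : N1 K C' <= N2 K C by apply: cnt_le; lra.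
have := N1_gt0; have := delta_le; have := delta_gt0; nra.
Qed.

End Step.

Section Transition.
Variables (C : seq 'rV[R]_d) (K : 'I_k) (i : 'I_n).
Let C' := rcons C (P i).
Hypotheses (C0 : C != [::]) (hact : act K C) (hact' : act K C').
Let C'0 : C' != [::] := rcons_neq0 C i.

Lemma excess_scale : scale K C' = scale K C ->
  excess K C' = excess K C * (Phi C' / Phi C).
Proof.
move=> e; have P0 := act_Phi_gt0 C0 hact.
have b0 := ball_gt0 C0 hact; rewrite /excess /N2 e -/(N2 K C).
by move: (7 / 256 * N2 K C * scale K C) b0 => b b0; field; rewrite !gt_eqF.
Qed.

(** From ln q <= q - 1 for the ratio q of the total costs. *)
Lemma ln_excess_le : scale K C' = scale K C ->
  ln (excess K C') <= ln (excess K C) + (Phi C' / Phi C - 1).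
Proof.
move=> e; have P0 := act_Phi_gt0 C0 hact; have P'0 := act_Phi_gt0 C'0 hact'.
have r0 : 0 < excess K C := lt_le_trans ltr01 (excess_ge1 C0 hact).
have q0 : 0 < Phi C' / Phi C by rewrite divr_gt0.
rewrite excess_scale// lnM ?posrE// lerD2l.
rewrite -[X in ln X](subrKC 1); apply: le_ln1Dx; lra.
Qed.

Lemma pot_sameE : scale K C' = scale K C ->
  pot K C' = pot K C + (lev K C' - lev K C) * (kap K / N2 K C).
Proof. by move=> e; rewrite /pot /N1 /N2 e; ring. Qed.

Lemma pot_same : scale K C' = scale K C -> pot K C' <= pot K C.
Proof.
move=> e; rewrite pot_sameE// gerDl mulr_le0_ge0 ?(ltW (kapN2_gt0 C0 hact))//.
rewrite subr_le0 /lev le_min ge_min lexx/= ge_min; apply/orP; right.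
apply: (le_trans (ln_excess_le e)); rewrite gerDl subr_le0.
rewrite ler_pdivrMr ?(act_Phi_gt0 C0 hact)// mul1r.
by apply: ler_sum => j _; exact: phi_pt_rcons_le.
Qed.

(** Below the truncation, [lev] falls by at least the relative drop g / Phi of the total cost; times
    kap / N2 this is 3/256 of [share]. *)
Lemma pot_same_gain : scale K C' = scale K C -> ln (excess K C) <= L ->
  Phi C' <= Phi C - 3 / 256 * N2 K C * scale K C ->
  pot K C' <= pot K C - 3 / 256 * share K C.
Proof.
move=> e lnL le; have P0 := act_Phi_gt0 C0 hact; rewrite pot_sameE// lerD2l.
set g := 3 / 256 * N2 K C * scale K C in le.
have -> : 3 / 256 * share K C = g / Phi C * (kap K / N2 K C).
  by rewrite /share /g; field; rewrite !gt_eqF ?(N2_gt0 C0 hact).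
rewrite -mulNr ler_wpM2r ?(ltW (kapN2_gt0 C0 hact))//.
have -> : lev K C = ln (excess K C) by apply/min_idPr.
have : lev K C' <= ln (excess K C') by rewrite ge_min lexx orbT.
have : Phi C' / Phi C <= (Phi C - g) / Phi C by rewrite ler_pM2r ?invr_gt0.
rewrite mulrBl divff ?gt_eqF//; have := ln_excess_le e; lra.
Qed.

Let x := kap K / N2 K C.

(** When [scale] shrinks, the level may be reset to [L], which costs at most [L * x]; the change of
    kap / N1 is kept exactly. *)
Lemma pot_shrink : scale K C' <= scale K C / 16 ->
  pot K C' <= pot K C + L * x - 2 * (L / delta) * (kap K / N1 K C' - kap K / N1 K C).
Proof.
move=> s16; rewrite /pot -/x.
have h1 : 0 <= (L - lev K C') * (kap K / N2 K C').
  by rewrite mulr_ge0 ?(ltW (kapN2_gt0 C'0 hact'))// subr_ge0 lev_le.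
have h2 : (L - lev K C) * x <= L * x.
  rewrite ler_wpM2r ?(ltW (kapN2_gt0 C0 hact))//.
  by have := lev_ge0 C0 hact; lra.
lra.
Qed.

Lemma kapN1_shrink : scale K C' <= scale K C / 16 -> x <= kap K / N1 K C'.
Proof.
move=> s16; have k0 := kap_gt0 C0 hact.
rewrite /x ler_pM2l// lef_pV2 ?posrE ?(N1_gt0 C'0 hact') ?(N2_gt0 C0 hact)//.
by apply: cnt_le; lra.
Qed.

Lemma pot_shrink_top : scale K C' <= scale K C / 16 -> pot K C' <= pot K C + L * x.
Proof.
move=> s16; apply: (le_trans (pot_shrink s16)); rewrite gerDl oppr_le0.
apply: mulr_ge0; first by rewrite mulr_ge0// ltW// Ldelta_gt0.
by rewrite subr_ge0 (le_trans (kapN1_le C0 hact))// kapN1_shrink.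
Qed.

(** The quotient kap / N1 grows from y to y' with y' - y >= delta y' >= delta x. Its weight 2 L /
    delta makes this a gain of 2 L x, twice the cost of a reset. *)
Lemma pot_shrink_gain : scale K C' <= scale K C / 16 ->
  N1 K C' <= (1 - delta) * N1 K C -> pot K C' <= pot K C - L * x.
Proof.
move=> s16 h; apply: (le_trans (pot_shrink s16)).
have h1 := kapN1_shrink s16; have n0 := N1_gt0 C0 hact; have n'0 := N1_gt0 C'0 hact'.
set y' := kap K / N1 K C' in h1 *; set y := kap K / N1 K C.
have yy' : y <= (1 - delta) * y'.
  have -> : y = N1 K C' / N1 K C * y' by rewrite /y /y'; field; rewrite !gt_eqF.
  rewrite ler_wpM2r ?ler_pdivrMr//; exact: ltW (kapN1_gt0 C'0 hact').
have d0 := delta_gt0.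
have : 2 * (L / delta) * (delta * x) <= 2 * (L / delta) * (y' - y).
  apply: ler_wpM2l; first by rewrite mulr_ge0// ltW// Ldelta_gt0.
  by have := ler_wpM2l (ltW d0) h1; lra.
have -> : 2 * (L / delta) * (delta * x) = 2 * (L * x).
  by field; rewrite gt_eqF.
lra.
Qed.

Lemma share_gain_le : 3 / 256 * share K C <= L * x.
Proof.
have := share_le C0 hact; rewrite -/x; have x0 := kapN2_gt0 C0 hact; rewrite -/x in x0.
have : x <= L * x by rewrite ler_peMl// ltW.
have := share_ge0 C0 hact; lra.
Qed.

Lemma pot_stay : pot K C' <= pot K C + L * x * (top K C i)%:R.
Proof.
have x0 := kapN2_gt0 C0 hact; rewrite -/x in x0.
have Lx : 0 <= L * x by rewrite mulr_ge0 ?(ltW x0)// (le_trans ler01).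
case: (scale_cases C0 hact hact') => [e|[s16 [h|->]]].
- by apply: (le_trans (pot_same e)); rewrite lerDl mulr_ge0.
- apply: (le_trans (pot_shrink_gain s16 h)).
  have : 0 <= L * x * (top K C i)%:R by rewrite mulr_ge0.
  lra.
- by rewrite mulr1; exact: pot_shrink_top.
Qed.

(** In the [top] case one [L * x] covers the reset and the other the claimed gain, by
    [share_gain_le]. *)
Lemma pot_stay_gain : ln (excess K C) <= L ->
  Phi C' <= Phi C - 3 / 256 * N2 K C * scale K C ->
  pot K C' <= pot K C - 3 / 256 * share K C + 2 * (L * x) * (top K C i)%:R.
Proof.
move=> lnL le; have x0 := kapN2_gt0 C0 hact; rewrite -/x in x0.
have Lx : 0 <= L * x by rewrite mulr_ge0 ?(ltW x0)// (le_trans ler01).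
have g := share_gain_le.
case: (scale_cases C0 hact hact') => [e|[s16 [h|->]]].
- by apply: (le_trans (pot_same_gain e lnL le)); rewrite lerDl mulr_ge0// mulr_ge0.
- apply: (le_trans (pot_shrink_gain s16 h)).
  have : 0 <= 2 * (L * x) * (top K C i)%:R by rewrite mulr_ge0// mulr_ge0.
  lra.
- by rewrite mulr1; apply: (le_trans (pot_shrink_top s16)); lra.
Qed.

End Transition.

End Potential.

(** * Expected change of the potential of one cluster *)

Section ExpectedPotential.
Variables (R : realType) (d n k l : nat) (P : 'I_n -> 'rV[R]_d).
Variables (a : 'I_n -> 'I_k) (cs : 'I_k -> 'rV[R]_d) (L : R).
Hypothesis P_inj : injective P.
Hypothesis l_gt0 : (0 < l)%N.
Hypothesis L_ge1 : 1 <= L.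
Hypothesis L_expk : k%:R <= expR L.

Local Notation Phi := (Phi P).
Local Notation cost := (cost P a).
Local Notation opt := (opt P a cs).
Local Notation act := (act P a cs).
Local Notation kap := (@kap R n k a).
Local Notation scale := (scale cs).
Local Notation N1 := (N1 P cs).
Local Notation N2 := (N2 P cs).
Local Notation excess := (excess P cs).
Local Notation delta := (delta l L).
Local Notation pot := (pot l P a cs L).
Local Notation share := (share P a cs).
Local Notation top := (top l P cs L).

Variables (C : seq 'rV[R]_d) (ch : {ffun 'I_l -> 'I_n} -> 'I_n).
Hypothesis C0 : C != [::].
Hypothesis Phi_gt0 : 0 < Phi C.
Hypothesis ch_codom : forall f : {ffun 'I_l -> 'I_n}, [exists j, f j == ch f].
Hypothesis ch_min : forall (f : {ffun 'I_l -> 'I_n}) j,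
  Phi (rcons C (P (ch f))) <= Phi (rcons C (P (f j))).

Definition D2prob i : R := phi_pt (P i) C / Phi C.
Local Notation E := (Ech D2prob ch).
Local Notation C' i := (rcons C (P i)).

Lemma D2prob_ge0 i : 0 <= D2prob i.
Proof. by rewrite divr_ge0 ?phi_pt_ge0 ?(ltW Phi_gt0). Qed.

Lemma D2prob_sum1 : \sum_i D2prob i = 1.
Proof. by rewrite -mulr_suml divff ?gt_eqF. Qed.

Definition next K i : R := if act K (C' i) then pot K (C' i) else 0.
Definition leaves K i : R := (~~ act K (C' i))%:R.

Section Cluster.
Variable K : 'I_k.
Hypothesis hact : act K C.
Let x := kap K / N2 K C.

(** Union bound over the draws: there are at most delta N1 <= 2 delta N2 outermost points, each of
    D^2-probability at most 4 scale / Phi. *)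
Lemma E_top : 2 * (L * x) * E (fun i => (top K C i)%:R) <= share K C / 512.
Proof.
have s0 := share_ge0 C0 hact; have d0 := delta_gt0 l_gt0 L_ge1.
have x0 : 0 < x := kapN2_gt0 C0 hact.
have Lx : 0 <= 2 * (L * x).
  by rewrite mulr_ge0// mulr_ge0 ?(ltW x0)// (le_trans ler01).
have [N12|N12] := leP (N1 K C) (2 * N2 K C); last first.
  rewrite (_ : E _ = 0); first by rewrite mulr0 divr_ge0.
  rewrite -(Ech_cst ch D2prob_sum1 0); congr (Ech _ _ _); apply: boolp.funext => i.
  by rewrite /top leNgt N12 andbF.
pose q := scale K C / Phi C.
have q0 : 0 <= q by apply: divr_ge0; [exact/ltW/scale_gt0|exact: ltW].
have le : \sum_i D2prob i * (top K C i)%:R <= 8 * delta * (N2 K C * q).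
  have oc : \sum_(i | outer l P cs L K C i) 1 <= delta * N1 K C :=
    outermost_count (fun i => dist2 (P i) (cs K)) (scale K C / 16) (ltW d0).
  have q4 : 0 <= 4 * q by rewrite mulr_ge0.
  apply: (@le_trans _ _ (4 * q * (delta * N1 K C))); last first.
    have : 0 <= q * delta by rewrite mulr_ge0// ltW.
    by move: N12; nra.
  apply: le_trans (ler_wpM2l q4 oc).
  rewrite [leRHS]mulr_sumr [leRHS]big_mkcond/=; apply: ler_sum => i _.
  rewrite /top N12 andbT; case: ifP => [|_]; last by rewrite mulr0.
  rewrite mulr1 /D2prob => /andP[h _]; rewrite mulr1 /q mulrA ler_pM2r ?invr_gt0//.
  exact: (ball_phi C0 hact).
have := Ech_union D2prob_ge0 D2prob_sum1 ch_codom (fun i => ler0n R (top K C i)).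
move=> h; have h1 : E (fun i => (top K C i)%:R) <= l%:R * (8 * delta * (N2 K C * q)).
  by apply: (le_trans h); rewrite ler_wpM2l.
apply: (le_trans (ler_wpM2l Lx h1)).
rewrite le_eqVlt; apply/orP; left; apply/eqP; rewrite /x /share /q /delta.
have L0 : L != 0 by rewrite gt_eqF// (lt_le_trans ltr01).
have N20 : N2 K C != 0 by rewrite gt_eqF// (N2_gt0 C0 hact).
have P0 : Phi C != 0 by rewrite gt_eqF.
have l0 : l%:R != 0 :> R by rewrite pnatr_eq0 -lt0n.
by field; rewrite L0 N20 P0 l0.
Qed.

Lemma mass_core : 7 / 512 * share K C <=
  \sum_(i | (a i == K) && (dist2 (P i) (cs K) <= scale K C / 256)%R) D2prob i.
Proof.
pose q := scale K C / Phi C.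
have q0 : 0 <= q by apply: divr_ge0; [exact/ltW/scale_gt0|exact: ltW].
apply: (@le_trans _ _ (7 / 256 * q * (kap K / 2))); first by rewrite /share /q; lra.
have q1 : 0 <= 7 / 256 * q by lra.
apply: le_trans (ler_wpM2l q1 (act_core C0 hact)) _.
rewrite mulr_sumr; apply: ler_sum => i /andP[_ h].
by rewrite mulr1 /D2prob /q mulrA ler_pM2r ?invr_gt0//; exact: (core_phi C0 hact).
Qed.

Lemma next_le i : next K i + leaves K i <= pot K C - leaves K i + 2 * (L * x) * (top K C i)%:R.
Proof.
have Lx : 0 <= L * x.
  by rewrite mulr_ge0 ?(ltW (kapN2_gt0 C0 hact))// (le_trans ler01).
have h0 : 0 <= L * x * (top K C i)%:R by rewrite mulr_ge0.
rewrite /next /leaves; case: ifP => h /=; last first.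
  by have := pot_ge2 l_gt0 L_ge1 C0 hact; lra.
have := pot_stay l_gt0 L_ge1 C0 hact h; rewrite -/x; lra.
Qed.

Lemma next_gain_le i : ln (excess K C) <= L ->
  next K i + leaves K i <= pot K C
    - 3 / 256 * share K C * (Phi (C' i) <= Phi C - 3 / 256 * N2 K C * scale K C)%R%:R
    + 2 * (L * x) * (top K C i)%:R.
Proof.
move=> lnL.
have Lx : 0 <= L * x.
  by rewrite mulr_ge0 ?(ltW (kapN2_gt0 C0 hact))// (le_trans ler01).
have h0 : 0 <= L * x * (top K C i)%:R by rewrite mulr_ge0.
have s0 := share_ge0 C0 hact.
have s1 : 3 / 256 * share K C <= 1.
  by have := share_le C0 hact; have := kapN2_le C0 hact; lra.
have p2 := pot_ge2 l_gt0 L_ge1 C0 hact.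
rewrite /next /leaves; case: ifP => h /=; last first.
  by case: (Phi _ <= _)%R; rewrite ?mulr1 ?mulr0; lra.
case: (boolP (Phi _ <= _)%R) => g; rewrite ?mulr1 ?mulr0.
  by have := pot_stay_gain l_gt0 L_ge1 C0 hact h lnL g; rewrite -/x; lra.
have := pot_stay l_gt0 L_ge1 C0 hact h; rewrite -/x; lra.
Qed.

(* Call a candidate good if it lowers the total cost about as much as solving the
   core of [K] does. If good candidates are likely, then the total cost drops and
   [lev] with it; if they are unlikely, then a candidate from [K] is likely to be
   the only good one, hence to be chosen. *)
Lemma expected_pot :
  E (next K) + E (leaves K) <= pot K C - cost K C / Phi C / 2048 + k%:R^-1.
Proof.
have s0 := share_ge0 C0 hact; have cl := cost_share C0 hact; have tl := E_top.
have k0 : 0 < k%:R :> R by rewrite ltr0n; apply: leq_ltn_trans (ltn_ord K).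
have ki0 : 0 <= k%:R^-1 :> R by rewrite invr_ge0 ltW.
set top_part := 2 * (L * x) * E _ in tl.
have El0 : 0 <= E (leaves K).
  by rewrite -(Ech_cst ch D2prob_sum1 0); apply: Ech_le => // i; exact: D2prob_ge0.
have B : E (next K) + E (leaves K) <= pot K C - E (leaves K) + top_part.
  have := Ech_le ch D2prob_ge0 next_le.
  rewrite EchD => /le_trans; apply.
  rewrite EchD [X in X + _]EchD Ech_cst ?D2prob_sum1// EchZ lerD2r lerD2l.
  rewrite (_ : E _ = E (fun i => -1 * leaves K i)); last first.
    by congr (Ech _ _ _); apply: boolp.funext => i; rewrite mulN1r.
  by rewrite EchZ mulN1r.
(* Above the truncation Phi is at least k times the core cost, so [share] is at most (512 / 7) / k <
   74 / k, and the term 1 / k absorbs everything. *)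
have [lnL|lnL] := leP (ln (excess K C)) L; last first.
  have sk : share K C <= 74 / k%:R.
    have r0 : 0 < excess K C := lt_le_trans ltr01 (excess_ge1 C0 hact).
    have : k%:R <= excess K C.
      apply: (le_trans L_expk); rewrite -[leRHS]lnK ?posrE//.
      by rewrite ler_expR ltW.
    rewrite /excess ler_pdivlMr ?(ball_gt0 C0 hact)// => h.
    rewrite ler_pdivlMr// /share mulrAC ler_pdivrMr//.
    have n2 := N2_ge C0 hact; have sc := scale_gt0 cs C K.
    have : k%:R * (7 / 256 * (kap K / 2) * scale K C) <= Phi C.
      apply: le_trans h; rewrite ler_wpM2l// ler_wpM2r//; first exact: ltW.
      lra.
    have : 0 <= kap K * scale K C * k%:R.
      have kp := kap_gt0 C0 hact.
      by apply: mulr_ge0; [apply: mulr_ge0|]; exact: ltW.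
    lra.
  move: sk; lra.
pose good i := (Phi (C' i) <= Phi C - 3 / 256 * N2 K C * scale K C)%R.
(* If good draws are likely, a gain of 3/256 [share] with probability at least 1/3, less [top_part],
   leaves share / 512, enough for cost / Phi / 2048. *)
have [h|h] := leP (1 / 2) (l%:R * \sum_(i | good i) D2prob i).
  have := Ech_heavy D2prob_ge0 D2prob_sum1 ch_min h; rewrite -/good => hh.
  have := Ech_le ch D2prob_ge0 (fun i => next_gain_le i lnL).
  rewrite EchD EchD [X in _ <= X + _ -> _]EchD Ech_cst ?D2prob_sum1// EchZ.
  rewrite (_ : E (fun i => - _) = - (3 / 256 * share K C) * E (fun i => (good i)%:R)); last first.
    by rewrite -EchZ; congr (Ech _ _ _); apply: boolp.funext => i; rewrite mulNr.
  rewrite -/top_part; nra.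
have mc := mass_core.
pose S i := (a i == K) && (dist2 (P i) (cs K) <= scale K C / 256)%R.
have Sgood i : S i -> good i by case/andP=> _; exact: (core_drop C0 hact).
(* Otherwise a core point of [K] is chosen with probability at least half the core mass, so E
   [leaves] is at least 7/1024 of [share]. *)
have := Ech_hit l_gt0 D2prob_ge0 D2prob_sum1 ch_codom ch_min Sgood (ltW h).
have : E (fun i => (S i)%:R) <= E (leaves K).
  apply: Ech_le => [i|i]; first exact: D2prob_ge0.
  rewrite /leaves; case: (boolP (S i)) => [/andP[aK _]|//].
  by rewrite /act hit_rcons// aK orbT.
have l1 : 1 <= l%:R :> R by rewrite ler1n.
have := ler_peMl (mass_ge0 D2prob_ge0 S) l1.
have : 7 / 512 * share K C <= \sum_(i | S i) D2prob i := mc.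
lra.
Qed.
End Cluster.

(** * Accounting over all clusters *)

Definition inactive_cost C : R := \sum_(K | ~~ act K C) cost K C.
Definition active_cost C : R := \sum_(K | act K C) cost K C.
Definition active_count C : nat := #|[pred K | act K C]|.
Definition active_pot C : R := \sum_(K | act K C) opt K * pot K C.

(* With [r] steps to go and [u] active clusters, at least [u - r] of them stay
   unhit; [deficit] charges each of these the mean active cost. *)
Definition deficit (r : nat) C : R :=
  active_cost C * Num.max 0 (1 - r%:R / (active_count C)%:R).

Lemma Phi_split D : Phi D = inactive_cost D + active_cost D.
Proof.
rewrite (Phi_cost P a) (bigID (fun K => act K D))/= addrC.
by congr (_ + _).
Qed.

Lemma active_cost_ge0 D : 0 <= active_cost D.
Proof. by apply: sumr_ge0 => K _; exact: cost_ge0. Qed.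

Lemma inactive_cost_ge0 D : 0 <= inactive_cost D.
Proof. by apply: sumr_ge0 => K _; exact: cost_ge0. Qed.

Lemma deficit_ge0 r D : 0 <= deficit r D.
Proof. by rewrite mulr_ge0 ?active_cost_ge0// le_max lexx. Qed.

Lemma active_count0 D : active_count D = 0%N -> active_cost D = 0.
Proof. by move=> /card0_eq u0; rewrite /active_cost big_pred0// => K; have := u0 K. Qed.

Lemma act_next K i : act K (C' i) -> act K C.
Proof. by move=> h; have [] := act_rcons P_inj C0 h. Qed.

Lemma active_cost_next i : active_cost (C' i) <= active_cost C.
Proof.
rewrite /active_cost [leLHS]big_mkcond [leRHS]big_mkcond/=; apply: ler_sum => K _.
case: ifP => [/act_next->|_]; first exact: cost_rcons_le.
by case: ifP => // _; exact: cost_ge0.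
Qed.

Lemma active_count_next i : (active_count (C' i) <= active_count C)%N.
Proof. by apply: subset_leq_card; apply/fintype.subsetP => K; rewrite !inE => /act_next. Qed.

Lemma active_count_hit i : act (a i) C -> (active_count (C' i) < active_count C)%N.
Proof.
move=> h; apply: proper_card; apply/fintype.properP; split.
  by apply/fintype.subsetP => K; rewrite !inE => /act_next.
by exists (a i); rewrite !inE// /act hit_rcons// eqxx orbT.
Qed.

Lemma active_pot_next i : active_pot (C' i) = \sum_(K | act K C) opt K * next K i.
Proof.
rewrite /active_pot [LHS]big_mkcond [RHS]big_mkcond/=; apply: eq_bigr => K _.
rewrite /next; case: ifP => [/act_next->//|_]; by rewrite mulr0 if_same.
Qed.

(** A cluster that turns inactive has either been hit, or its cost has fallen to at most
    [2048 * opt K]. *)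
Lemma inactive_cost_next i : inactive_cost (C' i) <= inactive_cost C +
  \sum_(K | act K C) ((a i == K)%:R * cost K (C' i) + 2048 * opt K * leaves K i).
Proof.
rewrite /inactive_cost (bigID (fun K => act K C))/= addrC; apply: lerD.
  rewrite [leLHS]big_mkcond [leRHS]big_mkcond/=; apply: ler_sum => K _.
  case: (boolP (act K C)) => h; rewrite ?andbF// andbT.
  rewrite (_ : ~~ act K (C' i)); first exact: cost_rcons_le.
  by apply: contra h => /act_next.
rewrite [leLHS]big_mkcond [leRHS]big_mkcond/=; apply: ler_sum => K _.
rewrite andbC /leaves; case: (boolP (act K C)) => //= h.
have c0 := cost_ge0 P a K (C' i); have o0 := opt_ge0 P a cs K.
case: (boolP (act K (C' i))) => /= h'.
  by rewrite mulr0 addr0 mulr_ge0.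
case: (eqVneq (a i) K) => aK /=.
  by rewrite mul1r mulr1 lerDl mulr_ge0.
rewrite mul0r add0r mulr1 leNgt; apply: contra h' => lt.
by rewrite /act lt hit_rcons// (negPf aK) orbF andbT; case/andP: h.
Qed.

Definition weight K : R := cost K C / Phi C.
(** Expected [opt] of the cluster of one D^2-sample, counting active clusters only. *)
Definition mean_opt : R := \sum_(K | act K C) opt K * weight K.

Lemma weight_ge0 K : 0 <= weight K.
Proof. by rewrite divr_ge0 ?cost_ge0// ltW. Qed.

Lemma hit_cost_D2prob K : \sum_i D2prob i * ((a i == K)%:R * cost K (C' i)) <= 16 * (opt K * weight K).
Proof.
rewrite (_ : \sum_i _ = (\sum_(i | a i == K) phi_pt (P i) C * cost K (C' i)) / Phi C).
  rewrite ler_pdivrMr//; have := hit_cost P a cs K C0.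
  by rewrite (_ : _ * Phi C = 16 * opt K * cost K C)// /weight; field; rewrite gt_eqF.
rewrite mulr_suml [RHS]big_mkcond/=; apply: eq_bigr => i _.
by case: (a i == K); rewrite ?mul0r ?mulr0// mul1r /D2prob mulrAC.
Qed.

Lemma cluster_D2prob K : \sum_i D2prob i * (a i == K)%:R = weight K.
Proof.
rewrite /weight /cost mulr_suml [RHS]big_mkcond/=; apply: eq_bigr => i _.
by case: (a i == K); rewrite ?mulr1 ?mulr0.
Qed.

Lemma E_inactive_cost : E (fun i => inactive_cost (C' i)) <= inactive_cost C +
  (16 * l%:R * mean_opt + 2048 * \sum_(K | act K C) opt K * E (leaves K)).
Proof.
apply: (le_trans (Ech_le ch D2prob_ge0 inactive_cost_next)).
rewrite EchD Ech_cst ?D2prob_sum1// lerD2l Ech_sum /mean_opt !mulr_sumr -big_split/=.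
apply: ler_sum => K _; rewrite EchD EchZ; apply: lerD; last by rewrite mulrA.
have g0 i : 0 <= (a i == K)%:R * cost K (C' i) by rewrite mulr_ge0 ?cost_ge0.
apply: (le_trans (Ech_union D2prob_ge0 D2prob_sum1 ch_codom g0)).
by rewrite -mulrA mulrCA ler_wpM2l//; exact: hit_cost_D2prob.
Qed.

Lemma Phi_next i : Phi (C' i) <=
  Phi C - \sum_(K | act K C) ((a i == K)%:R * (cost K C - cost K (C' i))).
Proof.
rewrite lerBrDr -lerBrDl !(Phi_cost P a) -sumrB [leLHS]big_mkcond/=; apply: ler_sum => K _.
have : 0 <= cost K C - cost K (C' i) by rewrite subr_ge0 cost_rcons_le.
by case: (act K C) => //; case: (a i == K); rewrite ?mul0r ?mul1r.
Qed.

(** Comparison with the first draw: it hits [K] with probability [weight K] and then brings the cost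
    of [K] down to O([opt K]) on average. *)
Lemma E_Phi : E (fun i => Phi (C' i)) <=
  Phi C - (\sum_(K | act K C) cost K C ^+ 2) / Phi C + 16 * mean_opt.
Proof.
apply: (le_trans (Ech_min l_gt0 D2prob_ge0 D2prob_sum1 ch_min)).
apply: (@le_trans _ _ (\sum_i D2prob i * (Phi C - \sum_(K | act K C) ((a i == K)%:R * (cost K C - cost K (C' i)))))).
  by apply: ler_sum => i _; rewrite ler_wpM2l ?D2prob_ge0//; exact: Phi_next.
under eq_bigr do rewrite mulrBr.
rewrite sumrB -[X in X - _]mulr_suml D2prob_sum1 mul1r -addrA lerD2l.
under [X in - X]eq_bigr do rewrite mulr_sumr.
rewrite exchange_big/=.
rewrite -lerN2 opprK opprD opprK /mean_opt mulr_suml mulr_sumr -sumrB.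
apply: ler_sum => K _.
under [leRHS]eq_bigr do rewrite mulrBr mulrBr.
rewrite sumrB lerB//; last exact: hit_cost_D2prob.
under [leRHS]eq_bigr do rewrite mulrA.
by rewrite -mulr_suml cluster_D2prob /weight expr2 mulrAC.
Qed.

(** Cauchy-Schwarz, in the form that the variance of the active costs is nonnegative. *)
Lemma active_cost_sqr : active_cost C * (active_cost C / (active_count C)%:R) <=
  \sum_(K | act K C) cost K C ^+ 2.
Proof.
have [u0|u0] := posnP (active_count C).
  by rewrite u0 invr0 !mulr0 sumr_ge0// => K _; exact: sqr_ge0.
set m := _ / _; have : 0 <= \sum_(K | act K C) (cost K C - m) ^+ 2.
  by apply: sumr_ge0 => K _; exact: sqr_ge0.
under eq_bigr do rewrite sqrrB.
rewrite big_split sumrB/= sumr_const -/(active_count C) => h.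
have e : m ^+ 2 *+ active_count C = active_cost C * m.
  by rewrite -mulr_natr /m; field; rewrite pnatr_eq0 -lt0n.
move: h; rewrite e [X in _ - X](eq_bigr (fun K => cost K C * (2 * m))) => [|K _]; last first.
  by rewrite mulr2n; ring.
rewrite -mulr_suml -/(active_cost C); lra.
Qed.

Lemma E_wasted : E (fun i => (~~ act (a i) C)%:R) <= l%:R * (inactive_cost C / Phi C).
Proof.
apply: le_trans (Ech_union D2prob_ge0 D2prob_sum1 ch_codom (fun i => ler0n R _)) _.
rewrite ler_wpM2l// le_eqVlt; apply/orP; left; apply/eqP.
rewrite /inactive_cost /cost.
rewrite [X in _ = X / _](_ : _ = \sum_(i | ~~ act (a i) C) phi_pt (P i) C).
  rewrite mulr_suml [RHS]big_mkcond/=; apply: eq_bigr => i _.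
  by case: (act (a i) C); rewrite ?mulr1 ?mulr0.
rewrite [RHS](partition_big a (fun K => ~~ act K C))//=.
apply: eq_bigr => K nK; apply: eq_bigl => i.
by case: (eqVneq (a i) K) => [->|]; rewrite ?nK ?andbF.
Qed.

(** A hit on an active cluster lowers the count to at most u - 1, and 1 - r / (u - 1) is the first
    factor. A wasted step adds at most one mean active cost B / u. *)
Lemma deficit_next r i (u := (active_count C)%:R : R) : (r < active_count C)%N ->
  deficit r (C' i) <= (u - r.+1%:R) / (u - 1) * active_cost (C' i)
    + (~~ act (a i) C)%:R * (active_cost C / u).
Proof.
move=> ru; have b'0 := active_cost_ge0 (C' i); have b0 := active_cost_ge0 C.
have ru' : r.+1%:R <= u by rewrite ler_nat.
have r0 : 0 <= r%:R :> R by []; have r1 : r%:R + 1 = r.+1%:R :> R := natr1 r.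
have u0 : 0 < u by lra.
have q0 : 0 <= (u - r.+1%:R) / (u - 1) by rewrite divr_ge0//; lra.
set q := _ / _ in q0 *.
have [/active_count0 e|u'0] := posnP (active_count (C' i)).
  by rewrite /deficit e mul0r mulr0 add0r mulr_ge0// divr_ge0// ltW.
set u' : R := (active_count (C' i))%:R; have u'p : 0 < u' by rewrite ltr0n.
have e1 : deficit r (C' i) = active_cost (C' i) * Num.max 0 (1 - r%:R / u') by [].
case: (boolP (act (a i) C)) => h /=.
  rewrite mul0r addr0 e1 mulrC ler_wpM2r// ge_max q0/=.
  have lt : u' <= u - 1 by rewrite lerBrDr natr1 ler_nat; exact: active_count_hit.
  have up : 0 < u - 1 := lt_le_trans u'p lt.
  rewrite (_ : q = 1 - r%:R / (u - 1)); last by rewrite /q -r1; field; rewrite gt_eqF.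
  by rewrite lerD2l lerN2 ler_wpM2l// lef_pV2 ?posrE.
have le : u' <= u by rewrite ler_nat; exact: active_count_next.
have le' : Num.max 0 (1 - r%:R / u') <= q + 1 / u.
  have iu0 : 0 <= 1 / u by rewrite mul1r invr_ge0 ltW.
  rewrite ge_max (addr_ge0 q0 iu0)/=.
  apply: (@le_trans _ _ (1 - r%:R / u)).
    by rewrite lerD2l lerN2 ler_wpM2l// lef_pV2 ?posrE.
  (* For u = 1 the quotient [q] has denominator 0 and equals 0. *)
  have [u1|u1] := eqVneq u 1.
    by rewrite u1 !divr1; lra.
  have up : 0 < u - 1 by move: u1; rewrite neq_lt => /orP[]; lra.
  rewrite -subr_ge0 (_ : _ - _ = (u - 1 - r%:R) / (u * (u - 1))).
    by rewrite divr_ge0 ?mulr_ge0//; lra.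
  by rewrite /q -r1; field; rewrite !gt_eqF.
rewrite e1 mul1r; apply: (le_trans (ler_wpM2l b'0 le')).
rewrite mulrDr [_ * q]mulrC lerD2l mulrA mulr1 ler_pM2r ?invr_gt0//.
exact: active_cost_next.
Qed.

Lemma mean_opt_ge0 : 0 <= mean_opt.
Proof. by apply: sumr_ge0 => K _; rewrite mulr_ge0 ?opt_ge0 ?weight_ge0. Qed.

(** The active cost is the total cost minus the inactive cost, so [E_Phi] bounds its mean. The term
    with [q] keeps its sign: in the total potential it is offset by the inactive cost, whose
    coefficient is at least 1 >= q. *)
Lemma E_deficit r : exists q : R, [/\ 0 <= q, q <= 1 &
  E (fun i => deficit r (C' i)) <= deficit r.+1 C
    + q * (inactive_cost C - E (fun i => inactive_cost (C' i)))
    + 16 * mean_opt + 2 * (l%:R * (inactive_cost C / r.+1%:R))].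
Proof.
have S0 := mean_opt_ge0; have A0 := inactive_cost_ge0 C; have B0 := active_cost_ge0 C.
have l1 : 1 <= l%:R :> R by rewrite ler1n.
have r0 : 0 < r.+1%:R :> R by [].
have Ar0 : 0 <= inactive_cost C / r.+1%:R by apply: divr_ge0.
(* With no more active clusters than remaining steps, the later deficit vanishes. *)
have [ur|ru] := leqP (active_count C) r.
  exists 0; split => //; rewrite mul0r addr0.
  have -> : E (fun i => deficit r (C' i)) = 0.
    rewrite -(Ech_cst ch D2prob_sum1 0); congr (Ech _ _ _); apply: boolp.funext => i.
    have [u0|u0] := posnP (active_count (C' i)).
      by rewrite /deficit active_count0// mul0r.
    rewrite /deficit max_l ?mulr0// subr_le0 ler_pdivlMr ?ltr0n// mul1r ler_nat.
    exact: leq_trans (active_count_next i) ur.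
  have := deficit_ge0 r.+1 C; have : 0 <= l%:R * (inactive_cost C / r.+1%:R) by rewrite mulr_ge0.
  by move: (l%:R * _) => y; lra.
pose u : R := (active_count C)%:R.
have r1 : r%:R + 1 = r.+1%:R :> R := natr1 r.
have ru' : r.+1%:R <= u by rewrite ler_nat.
have rr0 : 0 <= r%:R :> R by [].
have u0 : 0 < u by lra.
pose q := (u - r.+1%:R) / (u - 1).
have q0 : 0 <= q by apply: divr_ge0; lra.
have q1 : q <= 1.
  have [u1|u1] := eqVneq u 1; first by rewrite /q u1 subrr invr0 mulr0.
  have up : 0 < u - 1 by move: u1; rewrite neq_lt => /orP[]; lra.
  by rewrite ler_pdivrMr//; lra.
exists q; split => //.
have := Ech_le ch D2prob_ge0 (fun i => deficit_next i ru).
rewrite -/u -/q EchD EchZ => /le_trans; apply.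
have Bu0 : 0 <= active_cost C / u by rewrite divr_ge0// ltW.
rewrite (_ : E (fun i => _ * _) = active_cost C / u * E (fun i => (~~ act (a i) C)%:R)); last first.
  by rewrite -EchZ; congr (Ech _ _ _); apply: boolp.funext => i; rewrite mulrC.
have EB : E (fun i => active_cost (C' i)) =
    E (fun i => Phi (C' i)) - E (fun i => inactive_cost (C' i)).
  apply/eqP; rewrite eq_sym subr_eq -EchD; apply/eqP; congr (Ech _ _ _).
  by apply: boolp.funext => i; rewrite Phi_split addrC.
set A := inactive_cost C in A0 Ar0 *; set B := active_cost C in B0 Bu0 *.
have PAB : Phi C = A + B := Phi_split C.
have Au : A / u <= A / r.+1%:R by rewrite ler_wpM2l// lef_pV2 ?posrE.
have wasted : B / u * E (fun i => (~~ act (a i) C)%:R) <= l%:R * (A / r.+1%:R).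
  apply: (le_trans (ler_wpM2l Bu0 E_wasted)).
  rewrite mulrCA ler_wpM2l// -/A; apply: le_trans Au.
  rewrite [leLHS](_ : _ = A / u * (B / Phi C)); last by rewrite mulrACA [RHS]mulrACA [A * B]mulrC.
  rewrite ler_piMr ?divr_ge0 ?(ltW u0)// ler_pdivrMr// mul1r PAB; lra.
(* Since B^2 >= (B - A)(B + A) and Phi = A + B. *)
have sq : B / u - A / u <= (\sum_(K | act K C) cost K C ^+ 2) / Phi C.
  rewrite ler_pdivlMr//; apply: le_trans active_cost_sqr.
  rewrite -/B -/u PAB -mulrBl mulrAC [B * (B / u)]mulrA ler_pM2r ?invr_gt0//.
  have := sqr_ge0 A; nra.
have Eb : E (fun i => active_cost (C' i)) <=
    B - B / u + A / u + 16 * mean_opt + (A - E (fun i => inactive_cost (C' i))).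
  by rewrite EB; have := E_Phi; lra.
have defE : q * (B - B / u) = deficit r.+1 C.
  rewrite /deficit -/B -/u max_r; last by rewrite subr_ge0 ler_pdivrMr ?mul1r.
  have [u1|u1] := eqVneq u 1.
    have r0' : r%:R = 0 :> R by lra.
    by rewrite u1 !divr1 subrr mulr0 -r1 r0' add0r subrr mulr0.
  have up : 0 < u - 1 by move: u1; rewrite neq_lt => /orP[]; lra.
  by rewrite /q; field; rewrite !gt_eqF.
have h1 := ler_wpM2l q0 Eb.
have h2 : q * (A / u) <= l%:R * (A / r.+1%:R).
  apply: (@le_trans _ _ (A / r.+1%:R)); last by rewrite ler_peMl.
  by apply: le_trans Au; rewrite ler_piMl// divr_ge0// ltW.
have h3 : q * (16 * mean_opt) <= 16 * mean_opt by rewrite ler_piMl// mulr_ge0.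
move: (l%:R * (A / r.+1%:R)) wasted h2 => y wasted h2.
lra.
Qed.

(** Cost of the fixed comparison centres under the assignment [a]. *)
Definition OPT : R := \sum_K opt K.
(** Its increment 2 l / (r + 1) pays the last term of [E_deficit]. *)
Definition coef (r : nat) : R := 1 + 2 * l%:R * \sum_(j < r) j.+1%:R^-1.
(** The reserve [OPT * (r / k)] pays the loss of 1 / k per step in [expected_pot]. *)
Definition total_pot (c : R) (r : nat) C : R :=
  coef r * inactive_cost C + deficit r C + c * (active_pot C + OPT * (r%:R / k%:R)).

Lemma coef_ge1 r : 1 <= coef r.
Proof. by rewrite lerDl !mulr_ge0// sumr_ge0// => j _; rewrite invr_ge0. Qed.

Lemma E_active_pot : E (fun i => active_pot (C' i)) <=
  active_pot C - mean_opt / 2048 - \sum_(K | act K C) opt K * E (leaves K) + OPT / k%:R.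
Proof.
rewrite (_ : E _ = \sum_(K | act K C) opt K * E (next K)); last first.
  under [RHS]eq_bigr do rewrite -EchZ.
  rewrite -Ech_sum; congr (Ech _ _ _); apply: boolp.funext => i.
  exact: active_pot_next.
have oo : \sum_(K | act K C) opt K / k%:R <= OPT / k%:R.
  rewrite -mulr_suml ler_wpM2r ?invr_ge0// /OPT [leRHS](bigID (fun K => act K C))/=.
  by rewrite lerDl sumr_ge0// => K _; exact: opt_ge0.
apply: (@le_trans _ _ (active_pot C - mean_opt / 2048
  - \sum_(K | act K C) opt K * E (leaves K) + \sum_(K | act K C) opt K / k%:R)); last by rewrite lerD2l.
rewrite /active_pot /mean_opt [X in _ - X - _]mulr_suml.
apply: (@le_trans _ _ (\sum_(K | act K C) (opt K * pot K C
    - opt K * weight K / 2048 - opt K * E (leaves K) + opt K / k%:R))); last first.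
  by rewrite big_split !sumrB/=.
apply: ler_sum => K hK.
have := ler_wpM2l (opt_ge0 P a cs K) (expected_pot hK); rewrite -/(weight K).
move: (E (next K)) (E (leaves K)) (pot K C) (weight K) (opt K) (k%:R^-1) => x1 x2 x3 x4 x5 x6.
by lra.
Qed.

(** Used with x = l, y = [coef r], s = [mean_opt] and z the expected [opt] of the clusters turning
    inactive: the fall of [c * active_pot] pays for the growth of the other terms. *)
Lemma coef_absorb (c x y s z : R) : 1 <= x -> 1 <= y -> 0 <= s -> 0 <= z ->
  2048 * (32 * (x * y)) <= c ->
  y * (16 * x * s + 2048 * z) + 16 * s <= c * (s / 2048 + z).
Proof.
move=> x1 y1 s0 z0 hc; have xy : 1 <= x * y by nra.
have yxy : y <= x * y by nra.
have sz : 0 <= s / 2048 + z by rewrite addr_ge0// divr_ge0.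
apply: le_trans (ler_wpM2r sz hc).
have h1 := ler_wpM2r s0 xy; have h2 := ler_wpM2r z0 yxy.
have h3 : 0 <= x * y * z by rewrite mulr_ge0// (le_trans ler01).
have -> : y * (16 * x * s + 2048 * z) + 16 * s = 16 * (x * y * s) + 2048 * (y * z) + 16 * s by ring.
have -> : 2048 * (32 * (x * y)) * (s / 2048 + z) = 32 * (x * y * s) + 2048 * (32 * (x * y * z)) by field.
move: (x * y * s) (x * y * z) (y * z) h1 h2 h3 => u v t; lra.
Qed.

(** The supermartingale property: each estimate of one step is paid by a term of [total_pot]. *)
Lemma expected_total_pot c r : 2048 * (32 * (l%:R * coef r)) <= c ->
  E (fun i => total_pot c r (C' i)) <= total_pot c r.+1 C.
Proof.
move=> hc; have c1 := coef_ge1 r; have l1 : 1 <= l%:R :> R by rewrite ler1n.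
have lc : 1 <= l%:R * coef r by have := ler_pM ler01 ler01 l1 c1; rewrite mulr1.
have c0 : 0 <= c by lra.
rewrite /total_pot EchD EchD EchZ EchZ EchD Ech_cst ?D2prob_sum1//.
have [q [q0 q1 dq]] := E_deficit r.
have EA := E_inactive_cost; have EW := ler_wpM2l c0 E_active_pot.
have S0 := mean_opt_ge0.
set Z := \sum_(K | _) _ in EA EW.
have Z0 : 0 <= Z.
  apply: sumr_ge0 => K _; rewrite mulr_ge0 ?opt_ge0//.
  by rewrite -(Ech_cst ch D2prob_sum1 0); apply: Ech_le => // i; exact: D2prob_ge0.
have -> : coef r.+1 * inactive_cost C =
    coef r * inactive_cost C + 2 * (l%:R * (inactive_cost C / r.+1%:R)).
  by rewrite /coef big_ord_recr/=; ring.
have -> : OPT * (r.+1%:R / k%:R) = OPT * (r%:R / k%:R) + OPT / k%:R.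
  by rewrite -natr1; ring.
have h1 : (coef r - q) * (E (fun i => inactive_cost (C' i)) - inactive_cost C)
    <= coef r * (16 * l%:R * mean_opt + 2048 * Z).
  have X0 : 0 <= 16 * l%:R * mean_opt + 2048 * Z by rewrite addr_ge0// mulr_ge0// mulr_ge0.
  apply: (@le_trans _ _ ((coef r - q) * (16 * l%:R * mean_opt + 2048 * Z))).
    by rewrite ler_wpM2l//; lra.
  by rewrite ler_wpM2r//; lra.
have h2 : coef r * (16 * l%:R * mean_opt + 2048 * Z) + 16 * mean_opt <= c * (mean_opt / 2048 + Z).
  exact: coef_absorb.
move: (l%:R * (inactive_cost C / r.+1%:R)) dq => y dq.
move: (OPT / k%:R) (OPT * (r%:R / k%:R)) EW => o1 o2 EW.
move: dq h1 h2 EW; move: (E (fun i => deficit r (C' i))) (E (fun i => inactive_cost (C' i))).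
move=> D' A' dq h1 h2 EW; lra.
Qed.

End ExpectedPotential.

(** * Logarithmic estimates and the constant *)

Lemma harmonic_le (R : realType) (m : nat) :
  \sum_(j < m.+1) j.+1%:R^-1 <= 1 + ln m.+1%:R :> R.
Proof.
elim: m => [|m IH]; first by rewrite big_ord1 ln1 invr1 addr0.
rewrite big_ord_recr/=; apply: le_trans (lerD IH (lexx _)) _.
rewrite -addrA lerD2l; set y : R := m.+2%:R.
have y1 : 1 < y by rewrite ltr1n.
have y0 : 0 < y := lt_trans ltr01 y1.
(* The step reduces to ln (1 - 1 / y) <= - 1 / y. *)
have e : m.+1%:R = y * (1 + - y^-1) :> R.
  rewrite mulrDr mulr1 mulrN mulfV ?gt_eqF//.
  by rewrite /y -[m.+2%:R]natr1 addrK.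
have iy : y^-1 < 1 by rewrite invf_lt1.
move: (y^-1) e iy => z e z1; have p1 : 0 < 1 + - z by lra.
rewrite e lnM ?posrE//.
have : ln (1 + - z) <= - z by apply: le_ln1Dx; lra.
lra.
Qed.

Lemma ln2_ge (R : realType) : 1 / 2 <= ln 2 :> R.
Proof.
have : ln (1 + - (1 / 2)) <= - (1 / 2) :> R by apply: le_ln1Dx; lra.
by rewrite (_ : 1 + - (1 / 2) = 2^-1) ?lnV ?posrE//; lra.
Qed.

Definition cube_const (R : realType) : R := 3 * 2052 + 2048 * 96 * (5 + 4 * 8192).

Lemma cube_const_gt0 (R : realType) : 0 < cube_const R.
Proof.
rewrite /cube_const; move: (8192 : R) (ler0n R 8192) => N N0.
have : 0 < 5 + 4 * N by lra.
by move: (5 + _) => M M0; apply: addr_gt0; rewrite !mulr_gt0.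
Qed.

(** * From one step to the whole run *)

Section Algorithm.
Variables (R : realType) (d k l : nat) (X : seq 'rV[R]_d).
Variables (a : 'I_(size X) -> 'I_k) (cs : 'I_k -> 'rV[R]_d).
Hypothesis X_uniq : uniq X.
Hypothesis l_gt0 : (0 < l)%N.

Let n := size X.
Let P (i : 'I_n) : 'rV[R]_d := nth 0 X i.
Let L : R := 1 + ln k%:R.

Local Notation act := (act P a cs).
Local Notation cost := (cost P a).
Local Notation opt := (opt P a cs).
Local Notation OPT := (OPT P a cs).
Local Notation total_pot := (total_pot l P a cs L).
Local Notation coef := (coef R l).

Lemma P_inj : injective P.
Proof.
move=> i j /eqP; rewrite nth_uniq// => /eqP; exact: val_inj.
Qed.

Lemma phiE C : phi X C = Phi P C.
Proof. by rewrite /phi (big_nth 0) big_mkord. Qed.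

(** Turns a step into an [Ech] by picking an index for every tuple of draws; [p] serves both the
    uniform first step and D^2-sampling. *)
Lemma greedy_step r C (p : 'I_n -> R) : (forall i, prob X C (val i) = p i) ->
  exists ch : {ffun 'I_l -> 'I_n} -> 'I_n, [/\
    forall f : {ffun 'I_l -> 'I_n}, [exists j, f j == ch f],
    forall (f : {ffun 'I_l -> 'I_n}) j,
      Phi P (rcons C (P (ch f))) <= Phi P (rcons C (P (f j))) &
    greedy_exp X l r.+1 C = Ech p ch (fun i => greedy_exp X l r (rcons C (P i)))].
Proof.
move=> hp.
have /fin_all_exists[ch hch] : forall f : {ffun 'I_l -> 'I_n}, exists i,
    [/\ best X C [seq P (f j) | j <- enum 'I_l] = P i, [exists j, f j == i] &
    forall j, phi X (rcons C (P i)) <= phi X (rcons C (P (f j)))].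
  by move=> f; exact: best_codom.
exists ch; split=> [f|f j|].
- by have [] := hch f.
- by rewrite -!phiE; have [_ _] := hch f.
apply: eq_bigr => f _; have [<- _ _] := hch f; congr (_ * _).
by apply: eq_bigr => j _; exact: hp.
Qed.

Hypothesis k_gt0 : (0 < k)%N.

Lemma L_ge1 : 1 <= L.
Proof. by rewrite lerDl ln_ge0// ler1n. Qed.

Lemma L_expk : k%:R <= expR L.
Proof.
rewrite /L expRD lnK ?posrE ?ltr0n// ler_peMl//.
by have := @expR_ge1Dx R 1; lra.
Qed.

Lemma total_pot_ge c r C : C != [::] -> 0 <= c ->
  coef r * inactive_cost P a cs C + deficit P a cs r C <= total_pot c r C.
Proof.
move=> C0 c0; rewrite lerDl mulr_ge0// addr_ge0//.
  apply: sumr_ge0 => K hK; rewrite mulr_ge0 ?opt_ge0//.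
  by have := pot_ge2 l_gt0 L_ge1 C0 hK; lra.
by rewrite mulr_ge0 ?divr_ge0// sumr_ge0// => K _; exact: opt_ge0.
Qed.

Lemma coef_le r m : (r <= m)%N -> coef r <= coef m.
Proof.
move=> rm; rewrite lerD2l ler_wpM2l ?mulr_ge0//.
rewrite (big_ord_widen m (fun j => j.+1%:R^-1) rm) [leRHS](bigID (fun j : 'I_m => (j < r)%N))/=.
by rewrite lerDl sumr_ge0// => j _; rewrite invr_ge0.
Qed.

(** Induction on the remaining steps, with one [c] large enough for all of them. At r = 0 the
    deficit is the whole active cost, so [total_pot] dominates the total cost. *)
Lemma greedy_le_total_pot c m r C : C != [::] -> (r <= m)%N ->
  2048 * (32 * (l%:R * coef m)) <= c -> greedy_exp X l r C <= total_pot c r C.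
Proof.
move=> C0 rm hc.
have c0 : 0 <= c.
  apply: le_trans hc; rewrite !mulr_ge0//.
  exact: le_trans ler01 (coef_ge1 R l m).
elim: r C C0 rm => [|r IH] C C0 rm.
  apply: le_trans (total_pot_ge 0 C0 c0).
  rewrite /= phiE (Phi_split P a cs) /coef big_ord0 mulr0 addr0 mul1r lerD2l.
  by rewrite /deficit mul0r subr0 max_r ?ler01// mulr1.
have [p0|pn0] := eqVneq (phi X C) 0.
  rewrite greedy_exp_phi0//; apply: le_trans (total_pot_ge _ C0 c0).
  rewrite addr_ge0 ?deficit_ge0// mulr_ge0 ?inactive_cost_ge0//.
  exact: le_trans ler01 (coef_ge1 R l _).
have Phi0 : 0 < Phi P C by rewrite -phiE lt_def pn0 phi_ge0.
have hp (i : 'I_n) : prob X C (val i) = D2prob P C i.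
  by rewrite /prob (negPf pn0) /D2prob -phiE; case: (C) C0.
have [ch [ch1 ch2 ->]] := greedy_step r hp.
apply: le_trans (expected_total_pot a cs P_inj l_gt0 L_ge1 L_expk C0 Phi0 ch1 ch2 _); last first.
  apply: le_trans hc; rewrite !ler_wpM2l//; apply: coef_le; exact: ltnW.
apply: Ech_le => i; first exact: D2prob_ge0.
by apply: IH; [case: (C)|exact: ltnW].
Qed.

Lemma first_inactive_cost i : inactive_cost P a cs [:: P i] <=
  \sum_K ((a i == K)%:R * cost K [:: P i] + 2048 * opt K).
Proof.
rewrite /inactive_cost big_mkcond/=; apply: ler_sum => K _.
have c0 := cost_ge0 P a K [:: P i]; have o0 := opt_ge0 P a cs K.
have o1 : 0 <= 2048 * opt K by rewrite mulr_ge0.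
case: (boolP (act K [:: P i])) => h /=; first by rewrite addr_ge0// mulr_ge0.
case: (eqVneq (a i) K) => aK; first by rewrite mul1r lerDl.
rewrite mul0r add0r leNgt; apply: contra h => lt; rewrite /act lt andbT.
apply/existsP => -[j /andP[/eqP aj]]; rewrite inE => /eqP/P_inj ji.
by move: aK; rewrite -ji aj eqxx.
Qed.

(** For a uniform first centre, [intra_dist2] divided by n, with [kap K] at most n. *)
Lemma first_hit_cost K : (0 < n)%N ->
  \sum_(i < n) n%:R^-1 * ((a i == K)%:R * cost K [:: P i]) <= 4 * opt K.
Proof.
move=> n0; have np : 0 < n%:R :> R by rewrite ltr0n.
rewrite -mulr_sumr mulrC ler_pdivrMr//.
apply: (@le_trans _ _ (4 * kap R a K * opt K)).
  apply: le_trans (intra_dist2 P a cs K); rewrite [leRHS]big_mkcond/=.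
  by apply: ler_sum => i _; case: (a i == K); rewrite ?mul1r ?mul0r.
rewrite mulrAC ler_wpM2l ?mulr_ge0 ?opt_ge0//.
apply: (@le_trans _ _ (\sum_(i < n) 1)); last by rewrite sumr_const card_ord.
exact: sum_sub.
Qed.

(** The first centre hits its own cluster, so at most k - 1 clusters are active when k - 1 steps
    remain. *)
Lemma first_deficit i m : (k <= m.+1)%N -> deficit P a cs m [:: P i] = 0.
Proof.
move=> km; have [u0|u0] := posnP (active_count P a cs [:: P i]).
  by rewrite /deficit active_count0// mul0r.
rewrite /deficit max_l ?mulr0// subr_le0 ler_pdivlMr ?ltr0n// mul1r ler_nat.
rewrite -ltnS; apply: leq_trans km; rewrite -[k in (_ < k)%N]card_ord.
apply: proper_card; apply/fintype.properP; split.
  by apply/fintype.subsetP.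
exists (a i) => //; rewrite !inE negb_and negbK; apply/orP; left.
by apply/existsP; exists i; rewrite eqxx mem_head.
Qed.

Lemma active_pot_le C : C != [::] -> active_pot l P a cs L C <=
  (2 + 2 * L + 4 * (L / delta l L)) * OPT.
Proof.
move=> C0; set Q := _ + _.
have Q0 : 0 <= Q.
  by have := L_ge1; have := Ldelta_gt0 l_gt0 L_ge1; rewrite /Q; lra.
rewrite /OPT mulr_sumr [leLHS]big_mkcond/=; apply: ler_sum => K _.
have o0 := opt_ge0 P a cs K; case: ifP => h; last by rewrite mulr_ge0.
by rewrite mulrC ler_wpM2r//; exact: (pot_le l_gt0 L_ge1 C0 h).
Qed.

Lemma OPT_ge0 : 0 <= OPT.
Proof. by apply: sumr_ge0 => K _; exact: opt_ge0. Qed.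

Lemma greedy_le_opt : (0 < n)%N ->
  greedy_exp X l k [::] <= coef k * ((4 * l%:R + 2048) * OPT)
    + 2048 * (32 * (l%:R * coef k)) * ((3 + 2 * L + 4 * (L / delta l L)) * OPT).
Proof.
move=> n0; set c := 2048 * _; have O0 := OPT_ge0.
have ck1 : 1 <= coef k := coef_ge1 R l k.
have c0 : 0 <= c by rewrite !mulr_ge0// (le_trans ler01).
have kk : (k.-1 <= k)%N := leq_pred k.
rewrite -[X in greedy_exp _ _ X](prednK k_gt0).
have [ch [ch1 _ ->]] := @greedy_step k.-1 [::] (fun=> n%:R^-1) (fun=> erefl).
have n_ge0 (i : 'I_n) : 0 <= n%:R^-1 :> R by rewrite invr_ge0.
have n_sum1 : \sum_(i < n) n%:R^-1 = 1 :> R.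
  by rewrite sumr_const card_ord -[LHS]mulr_natr mulVf// pnatr_eq0 -lt0n.
pose g i K := (a i == K)%:R * cost K [:: P i].
apply: (@le_trans _ _ (Ech (fun=> n%:R^-1) ch (fun i =>
    coef k * \sum_K (g i K + 2048 * opt K)
    + c * ((3 + 2 * L + 4 * (L / delta l L)) * OPT)))).
  apply: Ech_le => // i.
  apply: (le_trans (@greedy_le_total_pot c k k.-1 [:: P i] _ kk (lexx _))) => //.
  rewrite /total_pot first_deficit ?prednK// addr0; apply: lerD.
    apply: (@le_trans _ _ (coef k * inactive_cost P a cs [:: P i])).
      by rewrite ler_wpM2r ?inactive_cost_ge0// coef_le.
    by rewrite ler_wpM2l ?(le_trans ler01 ck1)//; exact: first_inactive_cost.
  rewrite ler_wpM2l//.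
  have h1 := @active_pot_le [:: P i] isT.
  have h2 : OPT * (k.-1%:R / k%:R) <= OPT.
    by rewrite ler_piMr// ler_pdivrMr ?ltr0n// mul1r ler_nat.
  apply: (le_trans (lerD h1 h2)).
  by rewrite le_eqVlt; apply/orP; left; apply/eqP; ring.
rewrite EchD Ech_cst// lerD2r EchZ ler_wpM2l ?(le_trans ler01 ck1)//.
rewrite Ech_sum mulr_sumr; apply: ler_sum => K _.
rewrite EchD Ech_cst// [leRHS]mulrDl lerD2r.
have g0 i : 0 <= g i K by rewrite mulr_ge0 ?cost_ge0.
apply: (le_trans (Ech_union n_ge0 n_sum1 ch1 g0)).
by rewrite [4 * _]mulrC -mulrA ler_wpM2l//; exact: first_hit_cost.
Qed.

Lemma coef_le_L : coef k <= 3 * (l%:R * L).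
Proof.
have l1 : 1 <= l%:R :> R by rewrite ler1n.
have h : \sum_(j < k) j.+1%:R^-1 <= L by have := harmonic_le R k.-1; rewrite prednK.
have := ler_wpM2l (ler0n R l) h; have := ler_pM ler01 ler01 l1 L_ge1.
by rewrite /coef mulr1 -mulrA; lra.
Qed.

(** The leading term is c = O(l coef) = O(l^2 L) times the initial potential O(L / delta) = O(l L^2)
    per unit of [OPT]. *)
Lemma greedy_le_cube : (0 < n)%N -> greedy_exp X l k [::] <=
  cube_const R * (l%:R ^+ 3 * L ^+ 3 * OPT).
Proof.
move=> n0; apply: (le_trans (greedy_le_opt n0)).
have l1 : 1 <= l%:R :> R by rewrite ler1n.
have L1 := L_ge1; have O0 := OPT_ge0; have cl := coef_le_L.
have c1 : 1 <= coef k := coef_ge1 R l k.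
have -> : L / delta l L = 8192 * (l%:R * L ^+ 2).
  by rewrite /delta invrK; ring.
rewrite /cube_const; move: (8192 : R) (ler0n R 8192) (coef k) c1 cl => N N0 t c1 cl.
move: (l%:R : R) L OPT l1 L1 O0 cl => x y O x1 y1 O0 cl.
have x0 : 0 <= x by lra.
have y0 : 0 <= y by lra.
have xy1 : 1 <= x * y by nra.
have xx : x <= x ^+ 2 by rewrite expr2; nra.
have z1 : x ^+ 2 * y <= x ^+ 3 * y ^+ 3.
  rewrite (_ : x ^+ 3 * y ^+ 3 = x ^+ 2 * y * (x * y * y)); last by ring.
  by rewrite ler_peMr ?mulr_ge0 ?exprn_ge0//; nra.
have e1 : t * (4 * x + 2048) <= 3 * 2052 * (x ^+ 3 * y ^+ 3).
  apply: (@le_trans _ _ (3 * (x * y) * (2052 * x))).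
    by apply: ler_pM => //; lra.
  rewrite (_ : _ * _ = 3 * 2052 * (x ^+ 2 * y)); last by ring.
  by rewrite ler_wpM2l// mulr_ge0.
have e2 : 3 + 2 * y + 4 * (N * (x * y ^+ 2)) <= (5 + 4 * N) * (x * y ^+ 2).
  have : y <= x * y ^+ 2 by rewrite expr2; nra.
  have -> : (5 + 4 * N) * (x * y ^+ 2) = 5 * (x * y ^+ 2) + 4 * (N * (x * y ^+ 2)) by ring.
  move: (x * y ^+ 2) => v h; move: (N * v) => v'; lra.
have e3 : x * t * (3 + 2 * y + 4 * (N * (x * y ^+ 2))) <=
    3 * (5 + 4 * N) * (x ^+ 3 * y ^+ 3).
  apply: (@le_trans _ _ (x * (3 * (x * y)) * ((5 + 4 * N) * (x * y ^+ 2)))).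
    apply: ler_pM => //; first by rewrite mulr_ge0//; lra.
      by rewrite !addr_ge0 ?mulr_ge0 ?exprn_ge0.
    by rewrite ler_wpM2l.
  by rewrite le_eqVlt; apply/orP; left; apply/eqP; ring.
have f1 := ler_wpM2r O0 e1; have f2 := ler_wpM2r O0 e3.
have -> : t * ((4 * x + 2048) * O) = t * (4 * x + 2048) * O by ring.
have -> : 2048 * (32 * (x * t)) * ((3 + 2 * y + 4 * (N * (x * y ^+ 2))) * O) =
  2048 * 32 * (x * t * (3 + 2 * y + 4 * (N * (x * y ^+ 2))) * O) by ring.
have f3 : 0 <= 2048 * 32 :> R by rewrite mulr_ge0.
apply: (le_trans (lerD f1 (ler_wpM2l f3 f2))).
by rewrite le_eqVlt; apply/orP; left; apply/eqP; ring.
Qed.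

End Algorithm.

(** * Comparison with arbitrary centres and with the optimum *)

Lemma kmeanspp_le_phi (R : realType) (d : nat) (X C : seq 'rV[R]_d) (k l : nat) :
  uniq X -> (2 <= k)%N -> (1 <= l)%N -> size C = k ->
  greedy_kmeanspp_expected_cost X k l <=
  27 * cube_const R * l%:R ^+ 3 * ln k%:R ^+ 3 * phi X C.
Proof.
move=> Xu k2 l1 Ck; have k0 : (0 < k)%N := ltnW k2.
have C0 : C != [::] by rewrite -size_eq0 Ck -lt0n.
pose cs (K : 'I_k) := nth 0 C K.
have /fin_all_exists[a ha] : forall i : 'I_(size X), exists K : 'I_k,
    phi_pt (nth 0 X i) C = dist2 (nth 0 X i) (cs K).
  move=> i; have [c cC ->] := phi_pt_attained (nth 0 X i) C0.
  have lt : (index c C < k)%N by rewrite -Ck index_mem.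
  by exists (Ordinal lt); rewrite /cs /= nth_index.
have OPTE : OPT (fun i : 'I_(size X) => nth 0 X i) a cs = phi X C.
  rewrite phiE /Phi [RHS](partition_big a xpredT)//=; apply: eq_bigr => K _.
  by apply: eq_bigr => i /eqP <-; rewrite ha.
(* This uses k >= 2; its cube is the factor 27. *)
have L3 : 1 + ln k%:R <= 3 * ln k%:R :> R.
  have : ln 2 <= ln k%:R :> R by rewrite ler_ln ?posrE ?ltr0n// ler_nat.
  by have := ln2_ge R; lra.
have lnk : 0 <= ln k%:R :> R by rewrite ln_ge0// ler1n.
have A0 := ltW (cube_const_gt0 R); set A := cube_const R in A0 *.
(* For empty [X] there are no tuples of draws, and the expectation is an empty sum. *)
have [n0|n0] := posnP (size X).
  rewrite /greedy_kmeanspp_expected_cost -[X in greedy_exp _ _ X](prednK k0) /=.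
  rewrite big1 => [|f _]; first by rewrite !mulr_ge0 ?exprn_ge0 ?phi_ge0.
  by case: (f (Ordinal l1)) => i lt; exfalso; move: lt; rewrite n0.
apply: (le_trans (greedy_le_cube a cs Xu l1 k0 n0)); rewrite OPTE.
have -> : 27 * A * l%:R ^+ 3 * ln k%:R ^+ 3 * phi X C =
  A * (l%:R ^+ 3 * (3 * ln k%:R) ^+ 3 * phi X C) by ring.
rewrite ler_wpM2l// ler_wpM2r ?phi_ge0// ler_wpM2l ?exprn_ge0//.
by rewrite lerXn2r ?nnegrE ?mulr_ge0 ?addr_ge0.
Qed.

Theorem theorem1p1 (R : realType) :
  exists alpha : R, 0 < alpha /\
    forall (d : nat) (X : seq 'rV[R]_d) (k l : nat),
      uniq X -> (2 <= k)%N -> (1 <= l)%N ->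
      greedy_kmeanspp_expected_cost X k l
        <= alpha * (l%:R) ^+ 3 * (ln (k%:R)) ^+ 3 * OPTk X k.
Proof.
have A0 : 0 < 27 * cube_const R by apply: mulr_gt0 => //; exact: cube_const_gt0.
have le_phi := @kmeanspp_le_phi R.
exists (27 * cube_const R); move: (27 * cube_const R) A0 le_phi => A A0 le_phi.
split => // d X k l Xu k2 l1.
have lnk : 0 < ln k%:R :> R by rewrite ln_gt0// ltr1n.
set M := _ * _ ^+ 3; have M0 : 0 < M.
  by rewrite mulr_gt0 ?exprn_gt0// mulr_gt0 ?exprn_gt0// ltr0n.
(* In dimension 0 there may be no [k] distinct centres, and [inf] of the empty set is 0; but all
   costs vanish there. *)
case: d X Xu => [|d] X Xu.
  have phi0 (C : seq 'rV[R]_0) : phi X C = 0.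
    apply: big1 => x _; have [->//|/(phi_pt_attained x)[c _ ->]] := eqVneq C [::].
    by rewrite /dist2 big_ord0.
  have greedy0 i : forall C, greedy_exp X l i C = 0.
    elim: i => [|i IH] C /=; first exact: phi0.
    by apply: big1 => f _; rewrite IH mulr0.
  rewrite /greedy_kmeanspp_expected_cost greedy0 mulr_ge0 ?(ltW M0)//.
  rewrite /OPTk; set T := (X in inf X).
  have [->|/set0P T0] := eqVneq T set0; first by rewrite inf0.
  by apply: lb_le_inf => // _ [C _ <-]; exact: phi_ge0.
rewrite mulrC -ler_pdivrMr//; apply: lb_le_inf.
  (* The infimum is over a nonempty set: k distinct constant vectors. *)
  pose C : seq 'rV[R]_d.+1 := [seq const_mx j%:R | j <- iota 0 k].
  exists (phi X C); exists C => //; split; last by rewrite size_map size_iota.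
  rewrite map_inj_uniq ?iota_uniq// => i j /matrixP/(_ 0 0); rewrite !mxE => /eqP.
  by rewrite eqr_nat => /eqP.
move=> _ [C [_ Ck] <-]; rewrite ler_pdivrMr// mulrC.
exact: le_phi.
Qed.
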